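(* Let $\varphi:G/N\to H/M$ be a group homomorphism between groups with a Polish cover. The following conditions are equivalent: (1) $\varphi$ is Borel-definable; (2) $\varphi$ is a homomorphism with a Polish cover, i.e., its lifted graph $\widehat\Gamma(\varphi)=\{(g,h)\in G\times H:\varphi(gN)=hM\}$ is a Polish subgroup of $G\times H$; (3) there exist a group with a Polish cover $Z/L$, an airomorphism $\psi:Z/L\to H/M$, and a bijective airomorphism $\rho:Z/L\to G/N$ such that $\varphi=\psi\circ\rho^{-1}$.
   Context: A subgroup $N$ of a Polish group $G$ is a Polish subgroup if it carries a (necessarily unique) Polish group topology for which the inclusion $N\to G$ is continuous. A group with a Polish cover is a quotient group $G/N$ where $G$ is a Polish group and $N$ is a normal Polish subgroup of $G$ (the pair $(G,N)$ is part of the data). A lift of a group homomorphism $f:G/N\to H/M$ between groups with a Polish cover is a function $\tilde f:G\to H$ with $f(gN)=\tilde f(g)M$ for all $g\in G$. The homomorphism $f$ is Borel-definable if it has a Borel lift $G\to H$; it is an airomorphism if it has a lift $G\to H$ that is a continuous group homomorphism. *)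

(* Defs.v *)
From HB Require Import structures.
From mathcomp Require Import all_boot all_order all_algebra.
From mathcomp Require Import all_classical all_reals topology measure.

Set Implicit Arguments.
Unset Strict Implicit.
Unset Printing Implicit Defensive.

Local Open Scope classical_set_scope.
Local Open Scope quotient_scope.
Local Open Scope group_scope.

Definition separable_space (T : topologicalType) : Prop :=
  exists2 D : set T, countable D & dense D.

Definition completely_metrizable (R : realType) (T : topologicalType) : Prop :=
  exists (M : metricType R) (f : T -> M) (g : M -> T),
    [/\ cancel f g, cancel g f, continuous f, continuous g
      & forall F : set_system M, ProperFilter F -> cauchy F ->
          exists x : M, F --> x].

Definition polish_space (R : realType) (T : topologicalType) : Prop :=
  separable_space T /\ completely_metrizable R T.

(* No compatibility between the two structures is required here. *)
#[short(type="preTopologicalGroupType")]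
HB.structure Definition PreTopologicalGroup :=
  {G of Topological G & Group G}.

Definition polish_group (R : realType) (G : preTopologicalGroupType) : Prop :=
  [/\ continuous (fun x : G * G => x.1 * x.2),
      continuous (fun x : G => x^-1)
    & polish_space R G].

HB.mixin Record PreTopologicalGroup_isPolish (R : realType) G
    of PreTopologicalGroup G := {
  polish_groupP : polish_group R G
}.

#[short(type="polishGroupType")]
HB.structure Definition PolishGroup (R : realType) :=
  {G of PreTopologicalGroup G & PreTopologicalGroup_isPolish R G}.

HB.instance Definition _ (G H : preTopologicalGroupType) :=
  Group.on (G * H)%type.

Definition pack_groupClosed (G : groupType) (N : {pred G})
    (Ngrp : group_closed N) : groupClosed G :=
  HB.pack N (isMul1Closed.Build G N Ngrp.1)
    (isMulClosed.Build G N (group_closedM Ngrp))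
    (isInvClosed.Build G N (group_closedV Ngrp)).

Section Subgroup.
Context (G : groupType) (N : groupClosed G).

Definition subgroup_type : Type := {x : G | x \in N}.

HB.instance Definition _ := [isSub of subgroup_type for @proj1_sig G _].
HB.instance Definition _ := [Choice of subgroup_type by <:].

Fact subgroup_group_closed : group_closed N.
Proof. by split; [exact: gpred1 | exact: gpredF]. Qed.

HB.instance Definition _ :=
  SubChoice_isSubGroup.Build G (fun x => x \in N) subgroup_type
    subgroup_group_closed.

End Subgroup.

(* The group [G] with the topology [t] (given by its open sets), whatever other
   topology [G] may carry. *)
Definition topologized (G : groupType) (t : isOpenTopological G) : Type := G.

HB.instance Definition _ (G : groupType) (t : isOpenTopological G) :=
  Group.on (topologized t).
HB.instance Definition _ (G : groupType) (t : isOpenTopological G) :=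
  (t : isOpenTopological (topologized t)).

(* In general [t] is finer than the topology induced by [G]. *)
Definition polish_subgroup (R : realType) (G : preTopologicalGroupType)
    (N : groupClosed G) : Prop :=
  exists t : isOpenTopological (subgroup_type N),
    polish_group R (topologized t) /\
    continuous (val : topologized t -> G).

HB.mixin Record isConjgClosed (G : groupType) (N : {pred G}) := {
  gpredJl : forall x g : G, x \in N -> x ^ g \in N
}.

#[short(type="normalClosed")]
HB.structure Definition NormalClosed (G : groupType) :=
  {N of GroupClosed G N & isConjgClosed G N}.

Section QuotientGroup.
Context (G : groupType) (N : normalClosed G).
Implicit Types x y z g : G.

(* [lcoset_eq x y] holds iff [x N = y N]. *)
Definition lcoset_eq x y : bool := x^-1 * y \in N.

Fact lcoset_eq_refl : reflexive lcoset_eq.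
Proof. by move=> x; rewrite /lcoset_eq mulVg gpred1. Qed.

Fact lcoset_eq_sym : symmetric lcoset_eq.
Proof. by move=> x y; rewrite /lcoset_eq -gpredV invgM invgK. Qed.

Fact lcoset_eq_trans : transitive lcoset_eq.
Proof.
move=> y x z xy yz; rewrite /lcoset_eq.
by rewrite -(mulVKg y z) mulgA gpredM.
Qed.

Canonical lcoset_equiv :=
  EquivRel lcoset_eq lcoset_eq_refl lcoset_eq_sym lcoset_eq_trans.

Definition quotient_group : Type := {eq_quot lcoset_eq}.

HB.instance Definition _ := Choice.on quotient_group.
HB.instance Definition _ := EqQuotient.on quotient_group.

Definition cosetg : G -> quotient_group := \pi_quotient_group.

Fact eq_cosetg x y : (cosetg x == cosetg y) = (x^-1 * y \in N).
Proof. by rewrite /cosetg eqmodE. Qed.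

Fact cosetg_surj (u : quotient_group) : cosetg (repr u) = u.
Proof. exact: reprK. Qed.

Definition mulq (u v : quotient_group) : quotient_group :=
  cosetg (repr u * repr v).
Definition oneq : quotient_group := cosetg 1.
Definition invq (u : quotient_group) : quotient_group := cosetg (repr u)^-1.

Fact mulqE x y : mulq (cosetg x) (cosetg y) = cosetg (x * y).
Proof.
apply/eqP; rewrite eq_cosetg.
set x' := repr _; set y' := repr _.
have xN : x'^-1 * x \in N by rewrite -eq_cosetg cosetg_surj.
have yN : y'^-1 * y \in N by rewrite -eq_cosetg cosetg_surj.
have -> : (x' * y')^-1 * (x * y) = (x'^-1 * x) ^ y' * (y'^-1 * y).
  by rewrite /conjg invgM !mulgA mulgK.
by rewrite gpredM// gpredJl.
Qed.

Fact invqE x : invq (cosetg x) = cosetg x^-1.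
Proof.
apply/eqP; rewrite eq_cosetg invgK; set x' := repr _.
have xN : x'^-1 * x \in N by rewrite -eq_cosetg cosetg_surj.
rewrite -gpredV invgM invgK.
have -> : x * x'^-1 = (x'^-1 * x) ^ x'^-1.
  by rewrite /conjg invgK !mulgA mulgV mul1g.
exact: gpredJl.
Qed.

Fact mulqA : associative mulq.
Proof.
move=> u v w; rewrite -(cosetg_surj u) -(cosetg_surj v) -(cosetg_surj w).
by rewrite !mulqE mulgA.
Qed.

Fact mul1q : left_id oneq mulq.
Proof. by move=> u; rewrite -(cosetg_surj u) mulqE mul1g. Qed.

Fact mulq1 : right_id oneq mulq.
Proof. by move=> u; rewrite -(cosetg_surj u) mulqE mulg1. Qed.

Fact mulVq : left_inverse oneq invq mulq.
Proof. by move=> u; rewrite -(cosetg_surj u) invqE mulqE mulVg. Qed.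

Fact mulqV : right_inverse oneq invq mulq.
Proof. by move=> u; rewrite -(cosetg_surj u) invqE mulqE mulgV. Qed.

HB.instance Definition _ :=
  isGroup.Build quotient_group mulqA mul1q mulq1 mulVq mulqV.

Fact cosetgM : {morph cosetg : x y / x * y}.
Proof. by move=> x y; rewrite -mulqE. Qed.

Fact cosetg1 : cosetg (1 : G) = 1.
Proof. by []. Qed.

HB.instance Definition _ := isMultiplicative.Build G quotient_group cosetg cosetgM.
HB.instance Definition _ :=
  Multiplicative_isUMagmaMorphism.Build G quotient_group cosetg cosetg1.

End QuotientGroup.

(* [X : polishCover R] stands for G/N: the pair (G, N) is the data, the quotient
   group itself is [coverq X], and [coverpi] is g |-> gN. *)
Record polishCover (R : realType) := PolishCover {
  cover_group : polishGroupType R;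
  cover_kernel : normalClosed cover_group;
  cover_kernel_polish : polish_subgroup R cover_kernel
}.

Definition coverq (R : realType) (X : polishCover R) : groupType :=
  quotient_group (cover_kernel X).

Definition coverpi (R : realType) (X : polishCover R) :
    cover_group X -> coverq X :=
  @cosetg (cover_group X) (cover_kernel X).

HB.instance Definition _ (R : realType) (X : polishCover R) :=
  UMagmaMorphism.copy (@coverpi R X) (@cosetg _ (cover_kernel X)).

(* Written out because [g_sigma_algebraType] only carries its measurable
   structure over a pointedType. *)
Definition borel_fun (S T : topologicalType) (f : S -> T) : Prop :=
  forall B : set T, <<s (@open T) >> B -> <<s (@open S) >> (f @^-1` B).

Section CoverMorphisms.
Context (R : realType) (X Y : polishCover R).
Implicit Type phi : {multiplicative coverq X -> coverq Y}.

Definition is_lift phi (f : cover_group X -> cover_group Y) : Prop :=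
  forall g, phi (coverpi g) = coverpi (f g).

Definition borel_definable phi : Prop :=
  exists2 f : cover_group X -> cover_group Y, is_lift phi f & borel_fun f.

Definition airomorphism phi : Prop :=
  exists2 f : {multiplicative cover_group X -> cover_group Y},
    is_lift phi f & continuous f.

Definition lifted_graph phi : {pred cover_group X * cover_group Y} :=
  fun gh => phi (coverpi gh.1) == coverpi gh.2.

Fact lifted_graph_group_closed phi : group_closed (lifted_graph phi).
Proof.
have phi1 : phi 1 = 1 by apply: (mulgI (phi 1)); rewrite -gmulfM !mulg1.
have phiV u : phi u^-1 = (phi u)^-1.
  by apply: (mulgI (phi u)); rewrite -gmulfM !mulgV.
split; first by rewrite unfold_in /lifted_graph /= !gmulf1 phi1.
move=> [x1 x2] [y1 y2]; rewrite !unfold_in /lifted_graph /=.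
move=> /eqP x12 /eqP y12.
rewrite [coverpi (x1 / y1)]gmulfF [coverpi (x2 / y2)]gmulfF /=.
by rewrite gmulfM phiV x12 y12.
Qed.

Definition lifted_graph_group phi :
    groupClosed (cover_group X * cover_group Y)%type :=
  pack_groupClosed (lifted_graph_group_closed phi).

Definition polish_cover_hom phi : Prop :=
  @polish_subgroup R (cover_group X * cover_group Y)%type
    (lifted_graph_group phi).

End CoverMorphisms.

(* Main.v *)
Require Import Defs.
From HB Require Import structures.
From mathcomp Require Import all_boot all_order all_algebra.
From mathcomp Require Import all_classical all_reals topology measure.
From mathcomp Require Import ring.

(* (1) => (2): let f be a Borel lift of phi. The lifted graph Gamma is in
   bijection with G * M through j(y, m) = (y, f(y) m), and its multiplication
   becomes a Borel operation on the Polish space G * M, because M-valued maps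
   that are Borel into H are Borel into M (Lusin separation). Left translations
   of Gamma are skew products, hence preserve meager sets (Kuratowski-Ulam). As
   in Weil's reconstruction of a group topology from an invariant measure, with
   category instead of measure, the sets {g : A meets g^-1 A in a nonmeager set}
   for A open and nonempty generate the neighbourhoods of the unit of a group
   topology, which is Polish: if (u_n) is two-sided Cauchy then, for generic x,
   the sequence u_n x converges in G * M.
   (2) => (3): take Z = Gamma and L = the preimage of N in Gamma; the two
   projections induce psi and rho.
   (3) => (1): Z * N acts transitively on G by z y n^-1; by Effros' theorem the
   orbit map at 1 is open, so it has a Borel section, and composing the section
   with the lift of psi yields a Borel lift of phi. *)

Set Implicit Arguments.
Unset Strict Implicit.
Unset Printing Implicit Defensive.

Import Order.TTheory GRing.Theory Num.Theory.
Local Open Scope classical_set_scope.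

(** The obstacle in (1) => (2) is that [f] is only Borel: the topology carried over from G * M is
    Polish, but multiplication need not be continuous for it, and a Borel group need not be
    Polishable. What saves the construction is the skew-product form of translations: it makes the
    meager ideal invariant, so that meager sets can stand for Haar null sets and the Baire property
    for measurability. Meeting in a nonmeager set does not compose along products, whereas inclusion
    up to a meager set does; converting the former into the latter is the heart of the argument.
    Cauchy sequences are two-sided because the left uniformity of a Polish group need not be
    complete. The same construction, applied to a closed subgroup with its induced topology, gives a
    Polish group topology there; this is how the preimage of N in Gamma is seen to be Polish. In (3)
    => (1) the quotient spaces have no useful topology, so the inverse of rho is not lifted
    directly; the transitive action takes place on G itself. Complete metrics are unpacked once into
    [polish_base] and only rebuilt at the end, from a countable uniformity. *)

Lemma bigcup_unpickle (I : countType) T (F : I -> set T) :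
  \bigcup_i F i = \bigcup_n oapp F set0 (unpickle n).
Proof.
apply/seteqP; split=> x.
  by move=> [i _ Fx]; exists (pickle i) => //=; rewrite pickleK.
by move=> [n _]; case: (unpickle n) => [i|]//= Fx; exists i.
Qed.

(* The metric-free content of "separable and completely metrizable": a
   countable base whose members of index [i] with [psmall n i] play the role of
   sets of diameter less than [2^-n]. *)
Record polish_base (T : topologicalType) := PolishBase {
  pidx : countType;
  pbase : pidx -> set T;
  psmall : nat -> pidx -> Prop;
  pbase_open : forall i, open (pbase i);
  pbase_nbhs : forall n (U : set T) x, open U -> U x ->
    exists i, [/\ pbase i x, closure (pbase i) `<=` U & psmall n i];
  pbase_complete : forall u : nat -> pidx, (forall n, psmall n (u n)) ->
    (forall n, exists x, forall m, (m <= n)%N -> pbase (u m) x) ->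
    exists x, forall U, open U -> U x ->
      exists n, forall m, (n <= m)%N -> closure (pbase (u m)) `<=` U
}.

Arguments pbase {T} p i.
Arguments psmall {T} p n i.

Section PolishBaseTheory.
Context (T : topologicalType) (b : polish_base T).

Lemma pbase_open_bigcup (U : set T) n : open U ->
  U = \bigcup_(i in [set i | closure (pbase b i) `<=` U /\ psmall b n i])
        pbase b i.
Proof.
move=> oU; apply/seteqP; split=> x.
  by move=> /(pbase_nbhs b n oU)[i [? ? ?]]; exists i.
by move=> [i /= [iU _] xi]; apply: iU; exact: subset_closure.
Qed.

Lemma pbase_sub (U : set T) x : open U -> U x ->
  exists2 i, pbase b i x & pbase b i `<=` U.
Proof.
move=> oU Ux; have [i [ix iU _]] := pbase_nbhs b 0 oU Ux.
by exists i => // y iy; apply: iU; exact: subset_closure.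
Qed.

(** A neighbourhood of the limit contains some late [pbase b (u m)], which shares a point with
    [pbase b (u n)]; so the limit adheres to every member of the sequence, the early ones
    included. *)
Lemma pbase_completeW (u : nat -> pidx b) : (forall n, psmall b n (u n)) ->
  (forall n, exists x, forall m, (m <= n)%N -> pbase b (u m) x) ->
  exists2 x, forall n, closure (pbase b (u n)) x &
    forall U, open U -> U x ->
      exists n, forall m, (n <= m)%N -> closure (pbase b (u m)) `<=` U.
Proof.
move=> us ufip; have [x xP] := pbase_complete us ufip.
exists x => // n U; rewrite nbhsE => -[V [oV Vx] VU].
have [m mV] := xP V oV Vx.
have [y yP] := ufip (maxn n m).
exists y; split; first by apply: yP; rewrite leq_maxl.
by apply/VU/(mV m)/subset_closure/yP => //; rewrite leq_maxr.
Qed.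

Lemma pbase_nested (u : nat -> pidx b) : (forall n, psmall b n (u n)) ->
  (forall n, pbase b (u n.+1) `<=` pbase b (u n)) ->
  (forall n, pbase b (u n) !=set0) ->
  exists2 x, forall n, closure (pbase b (u n)) x &
    forall U, open U -> U x ->
      exists n, forall m, (n <= m)%N -> closure (pbase b (u m)) `<=` U.
Proof.
move=> us un u0; apply: pbase_completeW => // n.
have [x xn] := u0 n; exists x => m mn.
have {mn} -> : (m = n - (n - m))%N by rewrite subKn.
elim: (n - m)%N => [|k]; first by rewrite subn0.
have [kn|kn] := ltnP k n; first by rewrite subnS => IH; apply: un; rewrite prednK// subn_gt0.
by rewrite (eqP kn) (eqP (leqW kn)).
Qed.

End PolishBaseTheory.

Lemma hausdorff_separate (T : topologicalType) (x y : T) :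
  hausdorff_space T -> x <> y -> exists V : set T, exists W : set T,
    [/\ open V, open W, V x, W y & forall z, V z -> ~ W z].
Proof.
rewrite open_hausdorff => Th /eqP/Th[[V W] /= [/set_mem Vx /set_mem Wy]].
move=> [oV oW /eqP VW]; exists V, W; split=> // z Vz Wz.
by suff : (V `&` W) z by rewrite VW.
Qed.

(** * Polish bases of products, closed subspaces and Polish spaces *)

Section PolishBaseConstructions.

Lemma closure_setX_sub (S T : topologicalType) (A : set S) (B : set T) :
  closure (A `*` B) `<=` closure A `*` closure B.
Proof.
move=> [x y] xyAB; split=> /= [U Ux|U Uy].
  have [[a c] [[/= ? _] [/= ? _]]] := xyAB (U `*` setT) ltac:(by exists (U, setT) => //; split => //; exact: filterT).
  by exists a.
have [[a c] [[/= _ ?] [/= _ ?]]] := xyAB (setT `*` U) ltac:(by exists (setT, U) => //; split => //; exact: filterT).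
by exists c.
Qed.

Lemma open_setX (S T : topologicalType) (A : set S) (B : set T) :
  open A -> open B -> open (A `*` B).
Proof.
move=> oA oB; rewrite openE => -[x y] [/= Ax By].
by exists (A, B) => //; split; apply: open_nbhs_nbhs.
Qed.

Lemma open_rect (S T : topologicalType) (U : set (S * T)) x y :
  open U -> U (x, y) ->
  exists V : set S, exists W : set T,
    [/\ open V, open W, V x, W y & V `*` W `<=` U].
Proof.
rewrite openE => oU /oU[[V W] [/= ]].
rewrite !nbhsE => -[V' [oV' V'x] V'V] [W' [oW' W'x] W'W] VW.
exists V', W'; split=> // -[p q] [/= pp qq]; apply: VW; split => /=.
  exact: V'V.
exact: W'W.
Qed.

(** Transparent, because [borel_fun_pair] uses by conversion that the members are rectangles. *)
Definition polish_base_prod (S T : topologicalType) :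
  polish_base S -> polish_base T -> polish_base (S * T)%type.
Proof.
move=> b c.
apply: (@PolishBase _ (pidx b * pidx c)%type (fun i => pbase b i.1 `*` pbase c i.2)
  (fun n i => psmall b n i.1 /\ psmall c n i.2)).
- by move=> i; apply: open_setX; exact: pbase_open.
- move=> n U [x y] oU /(open_rect oU)[V [W [oV oW Vx Wy VWU]]].
  have [i [ix iV ni]] := pbase_nbhs b n oV Vx.
  have [j [jy jW nj]] := pbase_nbhs c n oW Wy.
  exists (i, j); split => // -[p q] /closure_setX_sub[/= /iV Vp /jW Wq].
  exact: VWU.
- move=> u us ufip.
  have [|x xP] := @pbase_complete _ b (fun n => (u n).1) (fun n => (us n).1).
    by move=> n; have [[x y] xyP] := ufip n; exists x => m /xyP[].
  have [|y yP] := @pbase_complete _ c (fun n => (u n).2) (fun n => (us n).2).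
    by move=> n; have [[x' y] xyP] := ufip n; exists y => m /xyP[].
  exists (x, y) => U oU /(open_rect oU)[V [W [oV oW Vx Wy VWU]]].
  have [m mV] := xP V oV Vx.
  have [n nW] := yP W oW Wy.
  exists (maxn m n) => k; rewrite geq_max => /andP[mk nk] [p q].
  by move=> /closure_setX_sub[/= /(mV _ mk) Vp /(nW _ nk) Wq]; exact: VWU.
Defined.

(** The hypothesis on [f] says that its range is closed: the limit found in [T] has to come from a
    point of [S]. *)
Definition polish_base_initial (S : choiceType) (T : topologicalType)
    (f : S -> T) : polish_base T ->
    (forall x, (forall U, open U -> U x -> exists s, U (f s)) ->
      exists s, f s = x) ->
  polish_base (initial_topology f).
Proof.
move=> b fcl.
have ncl (A : set T) :
    closure (f @^-1` A : set (initial_topology f)) `<=` f @^-1` closure A.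
  move=> x xA U Uf; have [|y [Ay Uy]] := xA (f @^-1` U).
    exact: initial_continuous.
  by exists (f y).
apply: (@PolishBase (initial_topology f) (pidx b) (fun i => f @^-1` pbase b i)
  (fun n i => psmall b n i)).
- by move=> i; exists (pbase b i) => //; exact: pbase_open.
- move=> n _ x [U oU <-] Ux; have [i [ix iU ni]] := pbase_nbhs b n oU Ux.
  by exists i; split => // y /ncl/iU.
- move=> u us ufip.
  have [|x xP] := @pbase_complete _ b u us.
    by move=> n; have [x xP] := ufip n; exists (f x).
  have [|s fs] := fcl x.
    move=> U oU Ux; have [n nU] := xP _ oU Ux.
    have [s sn] := ufip n; exists s; apply: (nU n) => //.
    by apply: subset_closure; exact: sn.
  exists s => _ [U oU <-] Us; have [|n nU] := xP _ oU; first by rewrite -fs.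
  by exists n => m /nU mU y /ncl/mU.
Qed.

Lemma ex_natSinv_lt (R : realType) (e : R) (n : nat) : (0 < e)%R ->
  exists2 m, (n <= m)%N & (m.+1%:R^-1 < e)%R.
Proof.
move=> /ltr_add_invr[m]; rewrite add0r => me.
exists (maxn n m); first exact: leq_maxl.
by rewrite (le_lt_trans _ me)// lef_pV2 ?posrE// ler_nat ltnS leq_maxr.
Qed.

Lemma polish_space_base (R : realType) (T : topologicalType) :
  polish_space R T -> polish_base T.
Proof.
move=> [/cid2[D Dcount Ddense]].
move=> /cid[M /cid[f /cid[g [fK gK fcont gcont Mcomp]]]].
have /cid[idx idx_inj] := pcard_injP Dcount.
pose r n : R := (n.+1%:R^-1)%R.
have r_gt0 n : (0 < r n)%R by rewrite /r invr_gt0.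
have r_le m n : (m <= n)%N -> (r n <= r m)%R.
  by move=> mn; rewrite /r lef_pV2 ?posrE// ler_nat ltnS.
(* The ball of radius [r i.2] about the point of [D] with code [i.1]; it is empty if no point has
   this code. *)
pose B (i : nat * nat) : set T :=
  [set x | exists d, [/\ D d, idx d = i.1 & (mdist (f d) (f x) < r i.2)%R]].
have ball_open (z : M) e : open [set y | (mdist z y < e)%R].
  rewrite openE => y /= zy; have e0 : (0 < e - mdist z y)%R by rewrite subr_gt0.
  apply/nbhs_ballP; exists (e - mdist z y)%R => //= w; rewrite ballEmdist/= => yw.
  by rewrite (le_lt_trans (metric_triangle _ y _))// -ltrBrDl.
(* Passing to the closure costs a second radius. Hence the constant 3 below (one radius to the
   centre, two back) and then 4, where the distance to the limit is added. *)
have clB i d x : D d -> idx d = i.1 -> closure (B i) x ->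
    (mdist (f d) (f x) < r i.2 + r i.2)%R.
  move=> Dd di xB; have : nbhs x (f @^-1` [set y | (mdist (f x) y < r i.2)%R]).
    apply: open_nbhs_nbhs; split=> /=; last by rewrite mdistxx.
    by apply: open_comp => // *; exact: fcont.
  move=> /xB[y [[d' [Dd' d'i d'y]] /= xy]].
  have dd' : d = d' by apply: idx_inj; rewrite ?inE// di.
  rewrite dd' (le_lt_trans (metric_triangle _ (f y) _))//.
  by rewrite ltrD// metric_sym.
have gU U x : open U -> U x ->
    exists2 e : R, (0 < e)%R & forall y, (mdist (f x) (f y) < e)%R -> U y.
  move=> oU Ux; have : nbhs (f x) (g @^-1` U).
    apply: open_nbhs_nbhs; split; last by rewrite /= fK.
    by apply: open_comp => // *; exact: gcont.
  move=> /nbhs_ballP[e /= e0 eU]; exists e => // y fxy.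
  by have := eU (f y); rewrite /= fK ballEmdist; apply.
apply: (@PolishBase T (nat * nat)%type B (fun n i => (n <= i.2)%N)).
- move=> i; rewrite (_ : B i = \bigcup_(d in [set d | D d /\ idx d = i.1])
      f @^-1` [set y | (mdist (f d) y < r i.2)%R]).
    by apply: bigcup_open => d _; apply: open_comp => // *; exact: fcont.
  apply/seteqP; split=> x; first by move=> [d [? ? ?]]; exists d.
  by move=> [d [? ?] ?]; exists d.
- move=> n U x oU Ux; have [e e0 eU] := gU U x oU Ux.
  have [m nm me] := ex_natSinv_lt n (divr_gt0 e0 (ltr0n R 3)).
  have [||d [/= xd Dd]] := Ddense (f @^-1` [set y | (mdist (f x) y < r m)%R]).
  + by exists x; rewrite /= mdistxx.
  + by apply: open_comp => // *; exact: fcont.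
  exists (idx d, m); split=> //; first by exists d; rewrite metric_sym.
  move=> y /(clB (idx d, m) d _ Dd erefl)/= dy; apply: eU.
  rewrite (le_lt_trans (metric_triangle _ (f d) _))//.
  rewrite (lt_le_trans (ltrD xd dy))//.
  have -> : e = (e / 3 + (e / 3 + e / 3))%R by field.
  by rewrite !lerD// ltW.
- move=> u us ufip.
  pose C n := f @` \bigcap_(m in [set m | (m <= n)%N]) B (u m).
  have C_anti m n : (m <= n)%N -> C n `<=` C m.
    by move=> mn _ [x xP <-]; exists x => // k /= km; apply: xP; exact: leq_trans mn.
  have FF : ProperFilter (filter_from setT C).
    apply: filter_from_proper; last first.
      by move=> n _; have [x xP] := ufip n; exists (f x); exists x.
    apply: filter_from_filter; first by exists 0%N.
    move=> i j _ _; exists (maxn i j) => // y yC.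
    by split; apply: C_anti yC; rewrite ?leq_maxl ?leq_maxr.
  have [|z Fz] := Mcomp _ FF.
    apply: cauchy_exP => e e0; have [n _ ne] := ex_natSinv_lt 0 e0.
    have [x /(_ n (leqnn n))[d [Dd dn _]]] := ufip n.
    exists (f d), n => // _ [y /(_ n (leqnn n))[d' [Dd' d'n d'y]] <-].
    rewrite ballEmdist/=.
    have -> : d = d' by apply: idx_inj; rewrite ?inE// dn.
    by rewrite (lt_trans (lt_le_trans d'y (r_le _ _ (us n)))).
  exists (g z) => U oU Uz; have [e e0 eU] := gU U _ oU Uz.
  have e4 : (0 < e / 4)%R by rewrite divr_gt0.
  have [m _ mC] := Fz _ (nbhsx_ballx z _ e4).
  have [n mn ne] := ex_natSinv_lt m e4.
  exists n => k nk y yB.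
  have [x xP] := ufip k; have [d [Dd dk dx]] := xP k (leqnn k).
  have dy := clB _ _ _ Dd dk yB.
  have : ball z (e / 4) (f x).
    apply: mC; exists x => // i /= im; apply: xP.
    by rewrite (leq_trans im)// (leq_trans mn).
  rewrite ballEmdist/= => zx; apply: eU; rewrite gK.
  rewrite (le_lt_trans (metric_triangle _ (f x) _))//.
  rewrite (le_lt_trans (lerD (lexx _) (metric_triangle _ (f d) _)))//.
  have uke : (r (u k).2 <= e / 4)%R.
    by rewrite (le_trans _ (ltW ne))// r_le// (leq_trans nk).
  rewrite (metric_sym _ (f d)).
  have -> : e = (e / 4 + (e / 4 + (e / 4 + e / 4)))%R by field.
  rewrite ltrD// ltr_leD//; first exact: lt_le_trans uke.
  by rewrite (le_trans (ltW dy))// lerD.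
Qed.

Lemma polish_space_hausdorff (R : realType) (T : topologicalType) :
  polish_space R T -> hausdorff_space T.
Proof.
move=> [_ [M [f [g [fK gK fcont gcont _]]]]] p q pq.
rewrite -(fK p) -(fK q); congr g; apply: metric_hausdorff => A B fA fB.
by have [y [? ?]] := pq _ _ (fcont p _ fA) (fcont q _ fB); exists (f y).
Qed.

End PolishBaseConstructions.

(** * Baire category *)

Section Meager.
Context (T : topologicalType).
Implicit Types A B U : set T.

Definition meager A := exists D : nat -> set T,
  (forall n, open (D n) /\ dense (D n)) /\ \bigcap_n D n `<=` ~` A.

(** Inclusion up to a meager set; equality up to a meager set is expressed by two of these. *)
Definition msub A B := meager (A `\` B).
(* The Baire property. *)
Definition mbaire A := exists U, [/\ open U, msub A U & msub U A].

Lemma meagerS A B : A `<=` B -> meager B -> meager A.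
Proof. by move=> AB [D [oD DB]]; exists D; split=> // x /DB + /AB. Qed.

Lemma meager0 : meager set0.
Proof.
exists (fun=> setT); split; last by rewrite setC0.
by move=> n; split; [exact: openT|move=> U U0 _; rewrite setIT].
Qed.

Lemma meager_bigcup_nat (A : nat -> set T) :
  (forall n, meager (A n)) -> meager (\bigcup_n A n).
Proof.
move=> /choice[D DP].
exists (fun n => if unpickle n is Some (i, j) then D i j else setT); split.
  move=> n; case: (unpickle n) => [[i j]|]; first by have [+ _] := DP i; apply.
  by split; [exact: openT|move=> U U0 _; rewrite setIT].
move=> x xD [n _]; have [_ /(_ x)] := DP n; apply => m _.
by have := xD (pickle (n, m)) I; rewrite pickleK.
Qed.

Lemma meager_bigcup (I : countType) (P : set I) (A : I -> set T) :
  (forall i, P i -> meager (A i)) -> meager (\bigcup_(i in P) A i).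
Proof.
move=> mA; rewrite bigcup_mkcond bigcup_unpickle; apply: meager_bigcup_nat.
move=> n; case: (unpickle n) => [i|] /=; last exact: meager0.
by case: ifPn => [/set_mem/mA//|_]; exact: meager0.
Qed.

Lemma meagerU A B : meager A -> meager B -> meager (A `|` B).
Proof.
move=> mA mB; rewrite -(bigcup2E A B); apply: meager_bigcup_nat => -[|[|n]] //=.
exact: meager0.
Qed.

Lemma meager_closure_boundary U : open U -> meager (closure U `\` U).
Proof.
move=> oU; exists (fun=> U `|` ~` closure U); split.
  move=> _; split.
    by apply: openU => //; apply: closed_openC; exact: closed_closure.
  move=> V [x Vx] oV; have [VU0|/set0P[y [Vy Uy]]] := eqVneq (V `&` U) set0.
    exists x; split => //; right => /(_ V).
    rewrite setIC VU0 => /(_ (open_nbhs_nbhs (conj oV Vx))) [? []].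
  by exists y; split=> //; left.
by move=> x /(_ 0 I)[Ux [_]|nUx [/nUx]].
Qed.

Lemma msubxx A : msub A A.
Proof. by rewrite /msub setDv; exact: meager0. Qed.

Lemma subset_msub A B : A `<=` B -> msub A B.
Proof. by move=> /subsets_disjoint AB; rewrite /msub setDE AB; exact: meager0. Qed.

Lemma msub_trans A B C : msub A B -> msub B C -> msub A C.
Proof.
move=> AB BC; apply: meagerS (meagerU AB BC) => x [Ax nCx].
by have [Bx|Bx] := pselect (B x); [right|left].
Qed.

Lemma meager_msub A B : msub A B -> meager B -> meager A.
Proof.
move=> AB mB; apply: meagerS (meagerU AB mB) => x Ax.
by have [Bx|Bx] := pselect (B x); [right|left].
Qed.

Lemma msubC A B : msub A B -> msub (~` B) (~` A).
Proof. by apply: meagerS => x [nBx /contrapT Ax]. Qed.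

Lemma msubI A B C : msub A B -> msub A C -> msub A (B `&` C).
Proof.
move=> mAB mAC; apply: meagerS (meagerU mAB mAC) => x [Ax].
by move=> /not_andP[|]; [left|right].
Qed.

Lemma msub_bigcup (I : countType) (P : set I) (F : I -> set T) B :
  (forall i, P i -> msub (F i) B) -> msub (\bigcup_(i in P) F i) B.
Proof.
move=> FB; apply: meagerS (meager_bigcup FB) => x [[i Pi Fx] nBx].
by exists i.
Qed.

Lemma msub_bigcup2 (I : countType) (F G : I -> set T) :
  (forall i, msub (F i) (G i)) -> msub (\bigcup_i F i) (\bigcup_i G i).
Proof.
move=> FG; apply: msub_bigcup => i _; apply: (msub_trans (FG i)).
by apply: subset_msub => x Gx; exists i.
Qed.

Lemma mbaire_open U : open U -> mbaire U.
Proof. by move=> oU; exists U; split=> //; exact: msubxx. Qed.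

Lemma mbaire_eq A B : msub A B -> msub B A -> mbaire A -> mbaire B.
Proof.
by move=> AB BA [U [oU AU UA]]; exists U; split=> //; exact: msub_trans AU || exact: msub_trans UA AB.
Qed.

(** The complement of an open [U] differs from the exterior of [U] only by the boundary of [U],
    which is nowhere dense. *)
Lemma mbaireC A : mbaire A -> mbaire (~` A).
Proof.
move=> [U [oU AU UA]]; exists (~` closure U); split.
- by apply: closed_openC; exact: closed_closure.
- apply: msubC; apply: msub_trans UA; exact: meager_closure_boundary.
- by apply: msub_trans (msubC AU); apply/subset_msub/subsetC/subset_closure.
Qed.

Lemma mbaire_bigcup (F : nat -> set T) :
  (forall n, mbaire (F n)) -> mbaire (\bigcup_n F n).
Proof.
move=> /choice[U UP]; exists (\bigcup_n U n); split.
- by apply: bigcup_open => n _; have [] := UP n.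
- by apply: msub_bigcup2 => n; have [] := UP n.
- by apply: msub_bigcup2 => n; have [] := UP n.
Qed.

Lemma mbaireI A B : mbaire A -> mbaire B -> mbaire (A `&` B).
Proof.
move=> mA mB; rewrite -(setCK (A `&` B)) setCI -(bigcup2E (~` A)).
apply: mbaireC; apply: mbaire_bigcup => -[|[|n]] /=.
- exact: mbaireC.
- exact: mbaireC.
- exact/mbaire_open/open0.
Qed.

Lemma sigma_algebra_mbaire : sigma_algebra setT mbaire.
Proof.
split; first exact/mbaire_open/open0.
  by move=> A; rewrite setTD; exact: mbaireC.
exact: mbaire_bigcup.
Qed.

Lemma borel_mbaire A : <<s (@open T) >> A -> mbaire A.
Proof.
move=> bA; apply: bA; split; first exact: sigma_algebra_mbaire.
exact: mbaire_open.
Qed.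

End Meager.

Section Baire.
Context (T : topologicalType) (b : polish_base T).

Theorem baire (U : set T) : open U -> meager U -> U = set0.
Proof.
move=> oU [D [oD DU]]; apply/seteqP; split=> // x0 Ux0.
have step (ni : pidx b) n : pbase b ni !=set0 -> exists j,
    [/\ pbase b j !=set0, closure (pbase b j) `<=` pbase b ni `&` D n & psmall b n j].
  move=> i0; have [oDn dD] := oD n.
  have [y yi] := dD _ i0 (pbase_open ni).
  have [||j [jy jD jn]] := pbase_nbhs b n (U := pbase b ni `&` D n) (x := y) => //.
    by apply: openI => //; exact: pbase_open.
  by exists j; split=> //; exists y.
pose good n i j := pbase b i !=set0 -> 
  [/\ pbase b j !=set0, closure (pbase b j) `<=` pbase b i `&` D n & psmall b n j].
have /choice[s sP] (ni : nat * pidx b) : exists j, good ni.1 ni.2 j.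
  have [/step-/(_ ni.1)[j jP]|?] := pselect (pbase b ni.2 !=set0).
    by exists j.
  by exists ni.2.
have [i0 [i0x i0U _]] := pbase_nbhs b 0 oU Ux0.
pose u := fix u n := if n is m.+1 then s (m, u m) else i0.
have u0 n : pbase b (u n) !=set0.
  by elim: n => [|n IH] /=; [exists x0|have [] := sP (n, u n) IH].
have uP n := sP (n, u n) (u0 n).
(* Shifted by one: the step from [u n] to [u n.+1] is the one that provides smallness [n] and a
   closure inside [D n]. *)
have [|||x xu xP] := @pbase_nested _ b (fun n => u n.+1).
- by move=> n; have [] := uP n.
- by move=> n y /subset_closure; have [_ + _] := uP n.+1 => /[apply] -[].
- by move=> n; exact: u0.
have xD n : D n x by have [_ /(_ x (xu n)) []] := uP n.
apply: (DU x) => //; apply: i0U; apply: subset_closure.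
by have [_ /(_ x (xu 0)) []] := uP 0.
Qed.

Lemma mbaire_nonmeager (A : set T) : mbaire A -> ~ meager A ->
  exists U, [/\ open U, U !=set0, msub U A & msub A U].
Proof.
move=> [U [oU AU UA]] nA; exists U; split => //.
apply/set0P/eqP => U0; apply: nA; apply: meager_msub AU _.
by rewrite U0; exact: meager0.
Qed.

Lemma comeager_neq0 (A : set T) : [set: T] !=set0 -> meager (~` A) -> A !=set0.
Proof.
move=> T0 mA; apply/set0P/eqP => A0; move: T0 => /set0P/eqP; apply.
by apply: baire; [exact: openT|rewrite -setC0 -A0].
Qed.

Lemma msub_open_neq0 (U A V : set T) : open U -> U !=set0 ->
  msub U A -> meager (U `\` V) -> A `&` V `&` U !=set0.
Proof.
move=> oU U0 UA UV; apply/set0P/eqP => e; move: U0 => /set0P/eqP; apply.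
apply: baire => //; apply: meagerS (meagerU UA UV) => x Ux.
have [Ax|] := pselect (A x); last by left.
right; split => // Vx; suff : set0 x by [].
by rewrite -e.
Qed.

End Baire.

(** * The Kuratowski-Ulam theorem and its converse *)

Section KuratowskiUlam.
Context (S T : topologicalType) (b : polish_base T).
Implicit Type A : set (S * T).

(** For a dense open [D n] and a nonempty base set of index [i], the points [x] whose section of
    [D n] meets that base set form a dense open set [E i n]. Any [x] lying in all of these has only
    dense open sections. *)
Theorem kuratowski_ulam A : meager A ->
  meager [set x | ~ meager [set y | A (x, y)]].
Proof.
move=> [D [oD DA]].
pose E (i : pidx b) n := [set x | pbase b i !=set0 -> exists2 y, pbase b i y & D n (x, y)].
have mE i n : meager (~` E i n).
  exists (fun=> E i n); split; last by move=> x /(_ 0 I)/= xE /(_ xE).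
  move=> _; have [oDn dD] := oD n; split.
    have [i0|i0] := pselect (pbase b i !=set0); last first.
      by rewrite (_ : E i n = setT); [exact: openT|apply/seteqP; split => // z _ /i0].
    rewrite openE => x /(_ i0)[y iy xy].
    have [V [W [oV oW Vx Wy VW]]] := open_rect oDn xy.
    rewrite /interior nbhsE; exists V; first by split.
    by move=> z Vz _; exists y => //; apply: VW.
  move=> V [x Vx] oV; have [[y iy]|i0] := pselect (pbase b i !=set0); last first.
    by exists x; split=> // /i0.
  have [||[x' y'] [[/= ? ?] ?]] := dD (V `*` pbase b i).
  - by exists (x, y).
  - by apply: open_setX => //; exact: pbase_open.
  by exists x'; split=> // _; exists y'.
apply: meagerS (meager_bigcup (P := setT)
  (fun (p : pidx b * nat) _ => mE p.1 p.2)) => x nxA.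
apply: contrapT => nE; apply: nxA.
exists (fun n => [set y | D n (x, y)]); split; last by move=> y yD; exact: DA.
move=> n; have [oDn dD] := oD n; split.
  rewrite openE => y /(open_rect oDn)[V [W [oV oW Vx Wy VW]]].
  by rewrite /interior nbhsE; exists W => // z Wz; apply: VW.
move=> V [y Vy] oV; have [i iy iV] := pbase_sub b oV Vy.
have : E i n x.
  by apply: contrapT => nEx; apply: nE; exists (i, n).
by move=> []; [exists y|move=> z /iV ? ?; exists z].
Qed.

(** Let [U] be open and equal to [A] up to a meager set. If [U] contained a nonempty rectangle
    [V * W], then for almost all [x] in [V] the set [W] would be meager, against the Baire
    theorem. *)
Lemma kuratowski_ulam_converse (a : polish_base S) A : mbaire A ->
  meager [set x | ~ meager [set y | A (x, y)]] -> meager A.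
Proof.
move=> [U [oU AU UA]] mA; apply: meager_msub AU _.
suff -> : U = set0 by exact: meager0.
apply/seteqP; split=> // -[x y] /(open_rect oU)[V [W [oV oW Vx Wy VW]]].
suff : V = set0 by move=> V0; rewrite V0 in Vx.
apply: (baire a) => //.
apply: meagerS (meagerU mA (kuratowski_ulam UA)) => x' Vx'.
apply/not_andP => -[/= mx UAx].
suff : W = set0 by move=> W0; rewrite W0 in Wy.
apply: (baire b) => //; apply: meagerS (meagerU mx UAx) => y' Wy'.
have [|] := pselect (A (x', y')); first by left.
by right; split => //=; apply: VW.
Qed.

End KuratowskiUlam.

(** * Borel maps *)

Definition borel (T : topologicalType) (A : set T) := <<s (@open T) >> A.

Section Borel.
Implicit Types S T V : topologicalType.

Lemma borel_open T (A : set T) : open A -> borel A.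
Proof. exact: sub_sigma_algebra. Qed.

Lemma borelC T (A : set T) : borel A -> borel (~` A).
Proof. by move=> bA; rewrite -setTD; exact: sigma_algebraCD. Qed.

Lemma borel_bigcup T (I : countType) (P : set I) (F : I -> set T) :
  (forall i, P i -> borel (F i)) -> borel (\bigcup_(i in P) F i).
Proof.
move=> bF; rewrite bigcup_mkcond bigcup_unpickle; apply: sigma_algebra_bigcup.
move=> n; case: (unpickle n) => [i|] /=; last exact: sigma_algebra0.
by case: ifPn => [/set_mem/bF//|_]; exact: sigma_algebra0.
Qed.

Lemma borel_bigcap T (I : countType) (P : set I) (F : I -> set T) :
  (forall i, P i -> borel (F i)) -> borel (\bigcap_(i in P) F i).
Proof.
move=> bF; rewrite -(setCK (\bigcap_(i in P) F i)) setC_bigcap.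
by apply: borelC; apply: borel_bigcup => i Pi; apply: borelC; exact: bF.
Qed.

Lemma borelI T (A B : set T) : borel A -> borel B -> borel (A `&` B).
Proof.
move=> bA bB; rewrite -(bigcap2E A B); apply: borel_bigcap => -[|[|n]] //= _.
by apply: borel_open; exact: openT.
Qed.

Lemma borel_funP S T (f : S -> T) :
  (forall U, open U -> borel (f @^-1` U)) -> borel_fun f.
Proof.
move=> fo B bB; apply: (bB [set B | borel (f @^-1` B)]).
split=> //; split=> /=.
- by rewrite preimage_set0; exact: sigma_algebra0.
- by move=> A bA; rewrite setTD preimage_setC; exact: borelC.
- by move=> A bA; rewrite preimage_bigcup; apply: sigma_algebra_bigcup.
Qed.

Lemma borel_fun_continuous S T (f : S -> T) : continuous f -> borel_fun f.
Proof.
move=> /continuousP fc; apply: borel_funP => U oU; apply: borel_open; exact: fc.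
Qed.

Lemma borel_fun_comp S T V (f : S -> T) (g : T -> V) :
  borel_fun f -> borel_fun g -> borel_fun (g \o f).
Proof. by move=> bf bg B /bg/bf. Qed.

Lemma borel_fun_base S T (b : polish_base T) (f : S -> T) :
  (forall i, borel (f @^-1` pbase b i)) -> borel_fun f.
Proof.
move=> fb; apply: borel_funP => U oU; rewrite (pbase_open_bigcup b 0 oU).
by rewrite preimage_bigcup; exact: borel_bigcup.
Qed.

Lemma borel_fun_pair S T V (b : polish_base T) (c : polish_base V)
    (f : S -> T) (g : S -> V) :
  borel_fun f -> borel_fun g -> borel_fun (fun x => (f x, g x)).
Proof.
move=> bf bg; apply: (borel_fun_base (b := polish_base_prod b c)).
move=> -[i j]; rewrite [_ @^-1` _](_ : _ = f @^-1` pbase b i `&` g @^-1` pbase c j).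
  by apply: borelI; [apply: bf|apply: bg]; apply: borel_open; exact: pbase_open.
by [].
Qed.

Lemma borel_fun_mbaire S T (f : S -> T) U :
  borel_fun f -> open U -> mbaire (f @^-1` U).
Proof. by move=> bf oU; apply: borel_mbaire; apply: bf; exact: borel_open. Qed.

End Borel.

(** * Separation of analytic sets by Borel sets *)

Section LusinSeparation.
Context (S T Y : topologicalType) (b : polish_base S) (c : polish_base T).
Context (f : S -> Y) (g : T -> Y).
Hypotheses (fc : continuous f) (gc : continuous g) (Yh : hausdorff_space Y).

Definition borel_separated (A : set S) (B : set T) := exists E : set Y,
  [/\ borel E, forall x, A x -> E (f x) & forall y, B y -> ~ E (g y)].

Lemma borel_separated_bigcup (I J : countType) (A : I -> set S) (B : J -> set T) :
  (forall i j, borel_separated (A i) (B j)) ->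
  borel_separated (\bigcup_i A i) (\bigcup_j B j).
Proof.
move=> sAB; have /choice[E EP] (ij : I * J) := sAB ij.1 ij.2.
exists (\bigcup_i \bigcap_j E (i, j)); split.
- by apply: borel_bigcup => i _; apply: borel_bigcap => j _; have [] := EP (i, j).
- by move=> x [i _ Ax]; exists i => // j _; have [_ + _] := EP (i, j); apply.
- by move=> y [j _ By] [i _ /(_ j Logic.I)]; have [_ _] := EP (i, j); apply.
Qed.

(** Cut an inseparable pair into countably many pieces of smallness [n]: some pair of pieces is
    still inseparable. Iterating shrinks both sides to points [x] and [y], which lie only in the
    closures, whence the form of the hypothesis. Disjoint open sets around [f x] and [g y] then
    separate a late pair. *)
Lemma borel_separated_closure (A : set S) (B : set T) :
  (forall x y, closure A x -> closure B y -> f x <> g y) -> borel_separated A B.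
Proof.
move=> AB; apply: contrapT => nAB.
have ne (A' : set S) (B' : set T) : ~ borel_separated A' B' ->
    A' !=set0 /\ B' !=set0.
  move=> nsep; split; apply/set0P/eqP => e0; apply: nsep.
    exists set0; split; first exact: sigma_algebra0.
      by move=> x; rewrite e0.
    by move=> y _ [].
  exists setT; split; first by apply: borel_open; exact: openT.
    by [].
  by move=> x; rewrite e0.
have step n (A' : set S) (B' : set T) : ~ borel_separated A' B' ->
  exists ij : pidx b * pidx c, [/\ psmall b n ij.1, psmall c n ij.2 &
    ~ borel_separated (A' `&` pbase b ij.1) (B' `&` pbase c ij.2)].
  move=> nsep; apply: contrapT => nex; apply: nsep.
  pose A'' i := A' `&` [set x | psmall b n i /\ pbase b i x].
  pose B'' i := B' `&` [set x | psmall c n i /\ pbase c i x].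
  have -> : A' = \bigcup_i A'' i.
    apply/seteqP; split=> x; last by move=> [i _ []].
    by move=> Ax; have [i [? _ ?]] := pbase_nbhs b n openT (x := x) I; exists i.
  have -> : B' = \bigcup_i B'' i.
    apply/seteqP; split=> x; last by move=> [i _ []].
    by move=> Ax; have [i [? _ ?]] := pbase_nbhs c n openT (x := x) I; exists i.
  apply: borel_separated_bigcup => i j; apply: contrapT => nsep.
  have [[x [_ [si _]]] [y [_ [sj _]]]] := ne _ _ nsep.
  apply: nex; exists (i, j); split=> // -[E [bE AE BE]]; apply: nsep.
  exists E; split=> // z [? [? ?]]; first exact: AE.
  exact: BE.
have [[i0 j0] _] := step 0 A B nAB.
have /choice[s sP] (p : nat * (set S * set T)) : exists ij : pidx b * pidx c,
    ~ borel_separated p.2.1 p.2.2 -> [/\ psmall b p.1 ij.1, psmall c p.1 ij.2 &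
    ~ borel_separated (p.2.1 `&` pbase b ij.1) (p.2.2 `&` pbase c ij.2)].
  have [?|/step-/(_ p.1)[ij ?]] := pselect (borel_separated p.2.1 p.2.2).
    by exists (i0, j0).
  by exists ij.
pose st := fix st n := if n is m.+1 then
  ((st m).1 `&` pbase b (s (m, st m)).1, (st m).2 `&` pbase c (s (m, st m)).2)
  else (A, B).
pose u n := s (n, st n).
have nst n : ~ borel_separated (st n).1 (st n).2.
  by elim: n => //= n IH; have [] := sP (n, st n) IH.
have uP n := sP (n, st n) (nst n).
have stS m n : (m < n)%N ->
    (st n).1 `<=` A `&` pbase b (u m).1 /\ (st n).2 `<=` B `&` pbase c (u m).2.
  have st0 k : (st k).1 `<=` A /\ (st k).2 `<=` B.
    elim: k => [|k [IH1 IH2]] /=; first by split.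
    by split=> x [] => [/IH1|/IH2].
  elim: n => //= n IH; rewrite ltnS leq_eqVlt => /predU1P[->|/IH[IH1 IH2]].
    by have [h1 h2] := st0 n; split=> x [] => [/h1|/h2].
  by split=> x [] => [/IH1|/IH2].
have [| |x xcl xP] := @pbase_completeW _ b (fun n => (u n).1).
- by move=> n; have [] := uP n.
- move=> n; have [[x xn] _] := ne _ _ (nst n.+1).
  by exists x => m mn; have [/(_ x xn)[]] := stS m n.+1 mn.
have [| |y ycl yP] := @pbase_completeW _ c (fun n => (u n).2).
- by move=> n; have [] := uP n.
- move=> n; have [_ [z zn]] := ne _ _ (nst n.+1).
  by exists z => m mn; have [_ /(_ z zn)[]] := stS m n.+1 mn.
have Ax : closure A x.
  move=> U; rewrite nbhsE => -[V [oV Vx] VU]; have [n nV] := xP V oV Vx.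
  have [[z zn] _] := ne _ _ (nst n.+1).
  have [/(_ z zn)[Az uz] _] := stS n n.+1 (ltnSn n).
  by exists z; split=> //; apply/VU/(nV n)/subset_closure.
have By : closure B y.
  move=> U; rewrite nbhsE => -[V [oV Vx] VU]; have [n nV] := yP V oV Vx.
  have [_ [z zn]] := ne _ _ (nst n.+1).
  have [_ /(_ z zn)[Az uz]] := stS n n.+1 (ltnSn n).
  by exists z; split=> //; apply/VU/(nV n)/subset_closure.
have [V [W [oV oW Vx Wy VW]]] := hausdorff_separate Yh (AB _ _ Ax By).
have [m mV] := xP (f @^-1` V) (open_comp (fun x _ => fc (x := x)) oV) Vx.
have [n nW] := yP (g @^-1` W) (open_comp (fun x _ => gc (x := x)) oW) Wy.
apply: (nst (maxn m n).+1); exists V; split; first exact: borel_open.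
  move=> z /(proj1 (stS _ _ (ltnSn _)))[_ uz]; apply: (mV (maxn m n)).
    exact: leq_maxl.
  exact: subset_closure.
move=> z /(proj2 (stS _ _ (ltnSn _)))[_ uz] Vz.
by apply: (VW _ Vz); apply: (nW (maxn m n)); [exact: leq_maxr|exact: subset_closure].
Qed.

End LusinSeparation.

(* A set open for the finer topology [T] and its complement in [T] are disjoint
   analytic subsets of [Y], hence separated by a Borel set of [Y]. *)
Lemma borel_fun_corestrict (X T Y : topologicalType) (b : polish_base T)
    (i : T -> Y) (f : X -> T) :
  hausdorff_space Y -> continuous i -> injective i ->
  borel_fun (i \o f) -> borel_fun f.
Proof.
move=> Yh ic iI bf; apply: borel_funP => W oW.
have /choice[E EP] (j : pidx b) : exists E : set Y, closure (pbase b j) `<=` W ->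
    [/\ borel E, forall x, pbase b j x -> E (i x) & forall y, ~ W y -> ~ E (i y)].
  have [jW|] := pselect (closure (pbase b j) `<=` W); last by exists set0.
  have [x y jx|E EP] := @borel_separated_closure T T Y b b i i ic ic Yh
      (pbase b j) (~` W).
    rewrite -(iffLR (closure_id _) (open_closedC oW)) => nWy /iI xy.
    by apply: nWy; rewrite -xy; exact: jW.
  by exists E.
rewrite [f @^-1` W](_ : _ =
    \bigcup_(j in [set j | closure (pbase b j) `<=` W]) (i \o f) @^-1` E j).
  by apply: borel_bigcup => j /EP[bE _ _]; exact: bf.
apply/seteqP; split=> x.
  move=> /(pbase_nbhs b 0 oW)[j [jx jW _]]; exists j => //=.
  by have [_ + _] := EP j jW; apply.
by move=> [j /EP[_ _ EW] /= Ex]; apply: contrapT => /EW.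
Qed.

(** * Metrization *)

Lemma completely_metrizable_homeo (R : realType) (S T : topologicalType)
    (f : S -> T) (g : T -> S) :
  cancel f g -> cancel g f -> continuous f -> continuous g ->
  completely_metrizable R T -> completely_metrizable R S.
Proof.
move=> fK gK fc gc [M [h [k [hK kK hc kc Mc]]]].
exists M, (h \o f), (g \o k); split=> //.
- by move=> x /=; rewrite hK fK.
- by move=> x /=; rewrite gK kK.
- by move=> x; apply: continuous_comp; [exact: fc|exact: hc].
- by move=> x; apply: continuous_comp; [exact: kc|exact: gc].
Qed.

Section BoundedPseudometric.
Context (R : realType) (P : pseudoMetricType R).
Context (bounded : forall x y : P, ball x 2%R y) (Ph : hausdorff_space P).

(** Turns the abstract balls of a pseudometric type into a distance; [bounded] ensures that the
    infimum is taken over a nonempty set. *)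
Definition pdist (x y : P) : R := inf [set e : R | (0 < e)%R /\ ball x e y].

Let has_lb (x y : P) : has_lbound [set e : R | (0 < e)%R /\ ball x e y].
Proof. by exists 0%R => e [/ltW]. Qed.

Let set_neq0 (x y : P) : [set e : R | (0 < e)%R /\ ball x e y] !=set0.
Proof. by exists 2%R; split. Qed.

Lemma pdist_ball x y e : (pdist x y < e)%R -> ball x e y.
Proof.
move=> /(inf_lt (set_neq0 x y))[d [_ xdy] /ltW de]; exact: (le_ball de xdy).
Qed.

Lemma ball_pdist x y e : (0 < e)%R -> ball x e y -> (pdist x y <= e)%R.
Proof. by move=> e0 xy; apply: ge_inf; [exact: has_lb|split]. Qed.

Lemma pdist_ge0 x y : (0 <= pdist x y)%R.
Proof. by apply: lb_le_inf => // e [/ltW]. Qed.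

Lemma pdistxx x : pdist x x = 0%R.
Proof.
apply/eqP; rewrite eq_le pdist_ge0 andbT; apply/ler_addgt0Pl => e e0.
by rewrite addr0 ball_pdist//; exact: ballxx.
Qed.

Lemma pdist_eq0 x y : pdist x y = 0%R -> x = y.
Proof.
move=> xy0; apply: Ph => A B /nbhs_ballP[e /= e0 eA] yB.
exists y; split; last exact: nbhs_singleton.
by apply/eA/pdist_ball; rewrite xy0.
Qed.

Lemma pdist_sym x y : pdist x y = pdist y x.
Proof. by congr inf; apply/seteqP; split=> e [e0 /ball_sym]. Qed.

Lemma pdist_triangle y x z : (pdist x z <= pdist x y + pdist y z)%R.
Proof.
apply/ler_addgt0Pl => e e0.
have e2 : (0 < e / 2)%R by rewrite divr_gt0.
have -> : (e + (pdist x y + pdist y z) =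
  (pdist x y + e / 2) + (pdist y z + e / 2))%R by field.
apply: ball_pdist; first by rewrite addr_gt0// ltr_wpDl// pdist_ge0.
by apply: (@ball_triangle _ _ y); apply: pdist_ball; rewrite ltrDl.
Qed.

Definition metrized : Type := P.
HB.instance Definition _ := Choice.on metrized.
HB.instance Definition _ := isMetric.Build R metrized
  pdistxx pdist_eq0 pdist_sym pdist_triangle.

Lemma metrized_ball (x : metrized) e y :
  ball x e y -> ball (x : P) e (y : P).
Proof. by rewrite ballEmdist => /pdist_ball. Qed.

Lemma metrized_continuous : continuous (idfun : P -> metrized).
Proof.
(* Half the radius, since [ball_pdist] gives only a non-strict bound. *)
move=> x A /nbhs_ballP[e /= e0 eA]; have e2 : (0 < e / 2)%R by rewrite divr_gt0.
apply/nbhs_ballP; exists (e / 2)%R => //= y xy; apply: eA.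
rewrite ballEmdist /=; apply: le_lt_trans (ball_pdist e2 xy) _.
by rewrite ltr_pdivrMr// ltr_pMr// ltr1n.
Qed.

Lemma continuous_metrized : continuous (idfun : metrized -> P).
Proof.
move=> x A /nbhs_ballP[e /= e0 eA].
by apply/nbhs_ballP; exists e => //= y /metrized_ball/eA.
Qed.

Lemma completely_metrizable_pseudometric :
  (forall F : set_system P, ProperFilter F -> cauchy F ->
    exists x : P, F --> x) -> completely_metrizable R P.
Proof.
move=> Pc; exists metrized, idfun, idfun; split => //.
- exact: metrized_continuous.
- exact: continuous_metrized.
move=> F FF /cauchyP Fc; have [|x Fx] := Pc F FF.
  apply: cauchy_exP => e /Fc[x xe]; exists x.
  by apply: filterS xe => y; exact: metrized_ball.
by exists x => A /metrized_continuous /Fx.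
Qed.

End BoundedPseudometric.

Lemma completely_metrizable_uniform (R : realType) (U : uniformType) :
  countable_uniformity U -> hausdorff_space U ->
  (forall F : set_system U, ProperFilter F -> cauchy F ->
    exists x : U, F --> x) -> completely_metrizable R U.
Proof.
move=> Uc Uh Ucomp.
apply: (@completely_metrizable_pseudometric R (countable_uniform Uc)) => //.
by move=> x y; exact: (@countable_uniform.countable_uniform_bounded R U Uc x y).
Qed.

(** * Group topologies *)

Section GroupTopology.
Local Open Scope group_scope.
Context (G : groupType) (U : nat -> set G).
Hypotheses (U1 : forall n, U n 1) (UV : forall n x, U n x -> U n x^-1).
Hypothesis U_anti : forall m n, (m <= n)%N -> U n `<=` U m.
Hypothesis UM : forall n, exists m, forall x y, U m x -> U m y -> U n (x * y).
Hypothesis UJ : forall n g, exists m, forall x, U m x -> U n (x ^ g).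

Definition nopen (A : set G) :=
  forall g, A g -> exists n, forall x, U n (g^-1 * x) -> A x.

Lemma nopenT : nopen setT. Proof. by move=> g _; exists 0%N. Qed.

Lemma nopenI : setI_closed nopen.
Proof.
move=> A B oA oB g [/oA[m mA] /oB[n nB]]; exists (maxn m n) => x xmn.
by split; [apply: mA|apply: nB]; apply: U_anti xmn; rewrite ?leq_maxl ?leq_maxr.
Qed.

Lemma nopen_bigcup (I : Type) (f : I -> set G) :
  (forall i, nopen (f i)) -> nopen (\bigcup_i f i).
Proof. by move=> fo g [i _ /fo[n nf]]; exists n => x /nf; exists i. Qed.

Definition ntopology : isOpenTopological G :=
  isOpenTopological.Build G nopenT nopenI nopen_bigcup.

Lemma ntopology_nbhsP (g : topologized ntopology) (A : set G) :
  nbhs g A <-> exists n, forall x, U n (g^-1 * x) -> A x.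
Proof.
rewrite nbhsE; split=> [[B [oB Bg] BA]|[n nA]].
  by have [n nB] := oB g Bg; exists n => x /nB/BA.
exists [set y | exists m, forall x, U m (y^-1 * x) -> A x]; last first.
  by move=> y /= [m]; apply; rewrite mulVg.
split; last by exists n.
move=> y [m mA]; have [k kU] := UM m; exists k => z yz; exists k => x zx.
by apply: mA; rewrite -(mulVKg z x) mulgA; exact: kU.
Qed.

Lemma ntopologyM : continuous (fun x : topologized ntopology * topologized ntopology =>
  x.1 * x.2 : topologized ntopology).
Proof.
move=> [g h] A /= /ntopology_nbhsP[n nA]; have [m mU] := UM n.
have [k kU] := UJ m h.
exists ([set x | U k (g^-1 * x)], [set x | U m (h^-1 * x)]).
  by split; apply/ntopology_nbhsP; [exists k|exists m].
move=> [x y] /= [xk ym]; apply: nA.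
have -> : (g * h)^-1 * (x * y) = (g^-1 * x) ^ h * (h^-1 * y).
  by rewrite /conjg invgM !mulgA mulgK.
by apply: mU => //; exact: kU.
Qed.

Lemma ntopologyV : continuous (fun x : topologized ntopology =>
  x^-1 : topologized ntopology).
Proof.
move=> g A /= /ntopology_nbhsP[n nA]; have [m mU] := UJ n g^-1.
apply/ntopology_nbhsP; exists m => x /UV/mU; rewrite /conjg invgM !invgK => gx.
by apply: nA; rewrite invgK; move: gx; rewrite !mulgA mulgK.
Qed.

Hypothesis Usep : forall x, (forall n, U n x) -> x = 1.
Hypothesis Usepar : exists2 D : set G, countable D &
  forall n g, exists2 d, D d & U n (g^-1 * d).
Hypothesis Ucomplete : forall u : nat -> G,
  (forall n, exists N, forall p q, (N <= p)%N -> (N <= q)%N ->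
    U n ((u p)^-1 * u q) /\ U n (u p * (u q)^-1)) ->
  exists x, forall n, exists N, forall p, (N <= p)%N -> U n (x^-1 * u p).

(** The two-sided uniformity. It induces the same topology as the left one, but it is the one for
    which Polish groups are complete, in accordance with the form of [Ucomplete]. *)
Let entourage2 : set_system (G * G) := filter_from setT
  (fun n => [set xy | U n (xy.1^-1 * xy.2) /\ U n (xy.1 * xy.2^-1)]).

Let entourage2_filter : Filter entourage2.
Proof.
apply: filter_from_filter; first by exists 0%N.
move=> i j _ _; exists (maxn i j) => //= xy [xy1 xy2].
by split; split; [apply: U_anti xy1|apply: U_anti xy2|
  apply: U_anti xy1|apply: U_anti xy2]; rewrite ?leq_maxl ?leq_maxr.
Qed.

Let entourage2_diagonal A : entourage2 A -> diagonal `<=` A.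
Proof.
by move=> [n _ nA] [x y] /diagonalP ->; apply: nA; rewrite /= mulVg mulgV.
Qed.

Let entourage2_inv A : entourage2 A -> entourage2 A^-1%relation.
Proof.
move=> [n _ nA]; exists n => // -[x y] /= [xy1 xy2]; apply: nA => /=.
by split; [move: xy1|move: xy2] => /UV; rewrite invgM invgK.
Qed.

Let entourage2_split A : entourage2 A ->
  exists2 B, entourage2 B & (B \; B `<=` A)%relation.
Proof.
move=> [n _ nA]; have [m mU] := UM n.
exists [set xy | U m (xy.1^-1 * xy.2) /\ U m (xy.1 * xy.2^-1)]; first by exists m.
move=> [x z] /= [y /= [xy1 xy2] [yz1 yz2]]; apply: nA; split => /=.
  by have := mU _ _ xy1 yz1; rewrite mulgA mulgK.
by have := mU _ _ xy2 yz2; rewrite mulgA mulgVK.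
Qed.

Lemma ntopology_polish (R : realType) : polish_group R (topologized ntopology).
Proof.
split; [exact: ntopologyM|exact: ntopologyV|].
split.
  have [D Dc DU] := Usepar; exists D => // O [g Og] oO.
  have [n nO] := oO g Og; have [d Dd gd] := DU n g.
  by exists d; split => //; apply: nO.
pose M : uniformType := HB.pack (Group.sort G) (isUniform.Build G
  entourage2_filter entourage2_diagonal entourage2_inv entourage2_split).
have ME : @entourage M = entourage2 by [].
have MnbhsP (g : M) A : nbhs g A <-> exists n, forall x,
    U n (g^-1 * x) -> A x.
  rewrite -nbhs_entourageE; split=> [[B]|[n nA]].
    rewrite ME => -[n _ nB] BA; have [m mU] := UJ n g^-1.
    exists (maxn m n) => x gx; apply: BA; apply/mem_set/nB; split=> /=.
      by apply: U_anti gx; exact: leq_maxr.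
    (* At a fixed [g], closeness on the right is closeness on the left up to inversion and a
       conjugation, which [UJ] controls. *)
    have -> : g * x^-1 = (g^-1 * x)^-1 ^ g^-1.
      by rewrite /conjg invgM !invgK !mulgA mulgK.
    by apply/mU/UV; apply: U_anti gx; exact: leq_maxl.
  exists [set xy | U n (xy.1^-1 * xy.2) /\ U n (xy.1 * xy.2^-1)].
    by rewrite ME; exists n.
  by move=> x /set_mem[/= /nA].
have fc : continuous (idfun : topologized ntopology -> M).
  by move=> g A /MnbhsP ?; apply/ntopology_nbhsP.
have gc : continuous (idfun : M -> topologized ntopology).
  by move=> g A /ntopology_nbhsP ?; apply/MnbhsP.
apply: (completely_metrizable_homeo _ _ fc gc) => //.
apply: completely_metrizable_uniform.
- apply/countable_uniformityP.
  exists (fun n => [set xy | U n (xy.1^-1 * xy.2) /\ U n (xy.1 * xy.2^-1)]).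
    by move=> A; rewrite ME => -[n _ nA]; exists n.
  by move=> n; rewrite ME; exists n.
- move=> p q pq; apply: (mulgI p^-1); rewrite mulVg; apply/esym/Usep => n.
  have [m mU] := UM n.
  have [||x [px qx]] := pq [set x | U m (p^-1 * x)] [set x | U m (q^-1 * x)].
  + by apply/MnbhsP; exists m.
  + by apply/MnbhsP; exists m.
  by have := mU _ _ px (UV qx); rewrite invgM invgK mulgA mulgK.
move=> F FF Fc.
have /choice[P PP] n : exists P, F P /\ forall x y, P x -> P y ->
    U n (x^-1 * y) /\ U n (x * y^-1).
  have [|[P Q] [/= FP FQ] PQ] :=
      Fc [set xy | U n (xy.1^-1 * xy.2) /\ U n (xy.1 * xy.2^-1)].
    by rewrite ME; exists n.
  exists (P `&` Q); split; first exact: filterI.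
  by move=> x y [Px _] [_ Qy]; exact: (PQ (x, y)).
(* Decreasing members of the Cauchy filter: points picked in them form a Cauchy sequence whose limit
   is also the limit of the filter. *)
pose W := fix W n := if n is m.+1 then W m `&` P n else P 0%N.
have FW n : F (W n).
  elim: n => [|n IH]; first by have [] := PP 0%N.
  by apply: filterI => //; have [] := PP n.+1.
have WP m n : (m <= n)%N -> W n `<=` P m.
  elim: n => [|n IH]; first by rewrite leqn0 => /eqP ->.
  by rewrite leq_eqVlt => /predU1P[->|/IH WPm] x [] // /WPm.
have /choice[u uW] n : exists x, W n x by exact: filter_ex (FW n).
have [n|x xP] := Ucomplete (u := u).
  exists n => p q np nq; have [_] := PP n.
  by apply; [exact: WP np _ (uW p)|exact: WP nq _ (uW q)].
exists x => A /MnbhsP[n nA]; have [m mU] := UM n; have [N NU] := xP m.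
have [FP PU] := PP m; apply: filterS FP => y Py; apply: nA.
have := mU _ _ (NU (maxn N m) (leq_maxl _ _))
  (proj1 (PU _ _ (WP _ _ (leq_maxr N m) _ (uW _)) Py)).
by rewrite mulgA mulgK.
Qed.

End GroupTopology.

(** * Polish group topologies from category-preserving translations *)

(** Only finitely many [i] have a code below [n]. This serves for the finitely many conditions that
    define a basic neighbourhood of the unit. *)
Lemma filter_pickle_lt (I : countType) T (F : set_system T) (FF : Filter F)
    (P : I -> set T) n :
  (forall i, F (P i)) -> F [set t | forall i, (pickle i < n)%N -> P i t].
Proof.
move=> FP; elim: n => [|n IH]; first by apply: filterS filterT.
case En : (@pickle_inv I n) => [i|].
  apply: filterS (filterI IH (FP i)) => t [tn ti] k.
  rewrite ltnS leq_eqVlt => /predU1P[kn|/tn//].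
  suff -> : k = i by [].
  by apply: Some_inj; rewrite -En -kn pickleK_inv.
apply: filterS IH => t tn k; rewrite ltnS leq_eqVlt => /predU1P[kn|/tn//].
by move: En; rewrite -kn pickleK_inv.
Qed.

Section CategoryGroup.
Local Open Scope group_scope.
Context (G : groupType) (X : topologicalType) (b : polish_base X).
Context (j : X -> G) (k : G -> X) (act : G -> X -> X).
Hypothesis jK : cancel j k.
Hypothesis j_act : forall g x, j (act g x) = g * j x.
Hypothesis act_meager : forall g A, meager A -> meager (act g @^-1` A).
Hypothesis act_mbaire : forall g U, open U -> mbaire (act g @^-1` U).
Hypothesis mul_mbaire : forall U, open U ->
  mbaire [set xy : X * X | U (act (j xy.1) xy.2)].
Hypothesis div_mbaire : forall U, open U ->
  mbaire [set xy : X * X | U (act (j xy.1)^-1 xy.2)].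

Implicit Types (A C U : set X) (g h : G).

Let B := pbase b.
Let B_open i : open (B i). Proof. exact: pbase_open. Qed.

Let actM g h x : act (g * h) x = act g (act h x).
Proof. by apply: (can_inj jK); rewrite !j_act mulgA. Qed.

Let act1 x : act 1 x = x.
Proof. by apply: (can_inj jK); rewrite j_act mul1g. Qed.

Let actK g : cancel (act g) (act g^-1).
Proof. by move=> x; rewrite -actM mulVg act1. Qed.

Let actKV g : cancel (act g^-1) (act g).
Proof. by move=> x; rewrite -actM mulgV act1. Qed.

Let pre_actM g h A : act h @^-1` (act g @^-1` A) = act (g * h) @^-1` A.
Proof. by apply/seteqP; split=> x /=; rewrite actM. Qed.

Let act_nmeager g A : ~ meager A -> ~ meager (act g @^-1` A).
Proof.
by move=> nA /(act_meager g^-1); rewrite pre_actM mulgV (_ : act 1 @^-1` A = A)//;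
  apply/seteqP; split=> x /=; rewrite act1.
Qed.

Let act_msub g A C : msub A C -> msub (act g @^-1` A) (act g @^-1` C).
Proof. exact: act_meager. Qed.

Let open_nmeager A : open A -> A !=set0 -> ~ meager A.
Proof. by move=> oA /set0P/eqP A0 /(baire b oA). Qed.

Let nmeager_msub A C : msub A C -> ~ meager A -> ~ meager C.
Proof. by move=> sAC nA mC; apply: nA; exact: meager_msub sAC mC. Qed.

Let translate g A : open A -> A !=set0 -> exists C,
  [/\ open C, C !=set0, msub C (act g @^-1` A) & msub (act g @^-1` A) C].
Proof.
move=> oA A0; apply: mbaire_nonmeager; first exact: act_mbaire.
by apply: act_nmeager; exact: open_nmeager.
Qed.

Let translate_base g A : open A -> A !=set0 -> exists2 i,
  B i !=set0 & msub (B i) (act g @^-1` A).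
Proof.
move=> oA A0; have [C [oC [x Cx] CA _]] := translate g oA A0.
have [i ix iC] := pbase_sub b oC Cx; exists i; first by exists x.
by apply: msub_trans CA; exact: subset_msub.
Qed.

(** The category counterpart of the positivity of the measure of the intersection of [A] with
    [g^-1 C]. *)
Definition hit g (A C : set X) := ~ meager (A `&` act g @^-1` C).

Let hit_msub g A A' C C' : msub A A' -> msub C C' -> hit g A C -> hit g A' C'.
Proof.
move=> sAA sCC; apply: nmeager_msub.
apply: meagerS (meagerU sAA (act_msub g sCC)) => x [[Ax Cx]] /= nAC.
have [A'x|] := pselect (A' x); last by left.
by right; split=> // C'x; apply: nAC.
Qed.

Let hit_inv g A C : hit g A C -> hit g^-1 C A.
Proof.
move=> gAC /(act_meager g); apply: (contra_not _ gAC); apply: meagerS.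
by move=> x [Ax Cx]; split=> //=; rewrite actK.
Qed.

Let hit_translate g h A C : msub C (act g^-1 @^-1` A) -> hit h A C ->
  hit (g^-1 * h) A A.
Proof.
move=> CA; rewrite /hit -pre_actM.
by move: (hit_msub (g := h) (msubxx A) CA).
Qed.

(* If [a c] is in [A] for almost all [(a, c)] in [A1 * A3], and [a^-1 c] is in
   [A3] for almost all [(a, c)] in [A2 * B3], then [g c = (g a) (a^-1 c)] is in
   [A] for almost all [c] in [B3] as soon as [g a] is in [A1] for nonmeagerly
   many [a] in [A1 `&` A2]. *)
Let key A : open A -> A !=set0 -> exists A1, exists A',
  [/\ open A1, A1 !=set0, open A', A' !=set0 &
      forall g, hit g A1 A1 -> msub A' (act g @^-1` A)].
Proof.
move=> oA A0; have XXb := polish_base_prod b b.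
have X_nmeager : ~ meager [set: X].
  by apply: (nmeager_msub _ (open_nmeager oA A0)); exact: subset_msub.
(* Each section of this set of pairs is a translate of [A], so the set is nonmeager by
   Kuratowski-Ulam; having the Baire property, it contains almost all of some nonempty open set. *)
have [|U [oU U0 UM _]] := mbaire_nonmeager (mul_mbaire oA).
  move=> /(kuratowski_ulam b); apply: (contra_not _ X_nmeager); apply: meagerS.
  by move=> x _ /=; apply: act_nmeager; exact: open_nmeager.
have [[a0 c0] U00] := U0.
have [A1 [A3 [oA1 oA3 A1a0 A3c0 A13]]] := open_rect oU U00.
pose M' := [set xy : X * X | A1 xy.1 /\ A3 (act (j xy.1)^-1 xy.2)].
have bM' : mbaire M'.
  rewrite (_ : M' = (A1 `*` setT) `&` [set xy | A3 (act (j xy.1)^-1 xy.2)]).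
    apply: mbaireI; last exact: div_mbaire.
    by apply: mbaire_open; apply: open_setX => //; exact: openT.
  by apply/seteqP; split=> -[x y] /= [] // [].
have [|U' [oU' U'0 U'M' _]] := mbaire_nonmeager bM'.
  move=> /(kuratowski_ulam b).
  apply: (contra_not _ (open_nmeager oA1 (ex_intro _ _ A1a0))); apply: meagerS.
  move=> x A1x /= mx; apply: (act_nmeager (g := (j x)^-1)
    (open_nmeager oA3 (ex_intro _ _ A3c0))).
  by apply: meagerS mx.
have [|[a1 c1] [[[A1a1 A3c1] _] U'11]] :=
  msub_open_neq0 (polish_base_prod b b) (V := setT) oU' U'0 U'M'.
  by rewrite setDT; exact: meager0.
have [A2 [B3 [oA2 oB3 A2a1 B3c1 A2B3]]] := open_rect oU' U'11.
exists (A1 `&` A2), B3; split=> //; first exact: openI.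
- by exists a1.
- by exists c1.
move=> g gA.
have N1 := kuratowski_ulam b UM.
have N2 := kuratowski_ulam b U'M'.
(* By [N1] and [N2] the exceptional first coordinates are meager, and for [N1] they stay so when
   pulled back by [act g]; a nonmeager set of candidates therefore contains a good [a]. *)
have : exists a, [/\ A1 (act g a), A2 a,
    meager [set y | (U `\` [set xy | A (act (j xy.1) xy.2)]) (act g a, y)] &
    meager [set y | (U' `\` M') (a, y)]].
  apply: contrapT => nex; apply: gA; apply: meagerS (meagerU (act_meager g N1) N2).
  move=> a [[A1a A2a] [A1ga A2ga]].
  have [m1|] := pselect (meager [set y |
    (U `\` [set xy | A (act (j xy.1) xy.2)]) (act g a, y)]); last by left.
  have [m2|] := pselect (meager [set y | (U' `\` M') (a, y)]); last by right.
  by exfalso; apply: nex; exists a.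
move=> [a [A1ga A2a m1 m2]].
apply: meagerS (meagerU (act_meager (j a)^-1 m1) m2) => c [B3c nA] /=.
have [A3c|nA3c] := pselect (A3 (act (j a)^-1 c)); last first.
  by right; split; [exact: A2B3|move=> -[]].
left; split; first by apply: A13.
by move: nA; rewrite /= j_act actM actKV.
Qed.

(** The future basic neighbourhoods of the unit. Testing only the base sets with code below [n]
    makes them a decreasing sequence. *)
Let U n : set G := [set g | forall i, (pickle i < n)%N ->
  B i !=set0 -> hit g (B i) (B i)].

Let U_anti m n : (m <= n)%N -> U n `<=` U m.
Proof. by move=> mn g gU i im; apply: gU; exact: leq_trans mn. Qed.

Let U1 n : U n 1.
Proof.
move=> i _ i0; rewrite /hit (_ : act 1 @^-1` B i = B i).
  by rewrite setIid; exact: open_nmeager.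
by apply/seteqP; split=> x /=; rewrite act1.
Qed.

Let UV n g : U n g -> U n g^-1.
Proof. by move=> gU i im i0; apply: hit_inv; exact: gU. Qed.

Let U_hit A : open A -> A !=set0 -> exists n, forall g, U n g -> hit g A A.
Proof.
move=> oA [x Ax]; have [i ix iA] := pbase_sub b oA Ax.
exists (pickle i).+1 => g /(_ i (ltnSn _)) hg.
by apply: hit_msub (hg _); [exact: subset_msub|exact: subset_msub|exists x].
Qed.

(** Trades nonmeager intersections for almost inclusions, which can be composed along products. *)
Let U_key A : open A -> A !=set0 -> exists A' n,
  [/\ open A', A' !=set0 & forall g, U n g -> msub A' (act g @^-1` A)].
Proof.
move=> oA A0; have [A1 [A' [oA1 A10 oA' A'0 A1A']]] := key oA A0.
have [n nA] := U_hit oA1 A10; exists A', n; split=> // g gU.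
by apply: A1A'; exact: nA.
Qed.

Let U_bound (P : pidx b -> nat -> Prop) n :
  (forall i, exists m, P i m) ->
  (forall i m m', (m <= m')%N -> P i m -> P i m') ->
  exists m, forall i, (pickle i < n)%N -> P i m.
Proof.
move=> Pex Pmono; have : \forall m \near \oo, forall i, (pickle i < n)%N -> P i m.
  apply: filter_pickle_lt => i; have [m Pm] := Pex i.
  by exists m => // m' /= mm'; exact: Pmono Pm.
by move=> /filter_ex.
Qed.

(** Two uses of [U_key] give an open [A'] that [h] sends almost into [A], which [g] sends almost
    into [B i]. Taking units for [g] and [h] shows that [A'] is also almost inside [B i], so [A']
    witnesses the hit. *)
Let UM n : exists m, forall g h, U m g -> U m h -> U n (g * h).
Proof.
have [i|i m m' mm' Pm i0 g h /(U_anti mm') gU /(U_anti mm')|m mP] := @U_bound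
  (fun i m => B i !=set0 -> forall g h, U m g -> U m h ->
    hit (g * h) (B i) (B i)) n.
- have [i0|?] := pselect (B i !=set0); last by exists 0%N.
  have [A [p [oA A0 pA]]] := U_key (B_open i) i0.
  have [A' [q [oA' A'0 qA']]] := U_key oA A0.
  exists (maxn p q) => _ g h gU hU.
  have gA := pA _ (U_anti (leq_maxl p q) gU).
  have hA' := qA' _ (U_anti (leq_maxr p q) hU).
  have ghA' : msub A' (act (g * h) @^-1` B i).
    by apply: msub_trans hA' _; rewrite -pre_actM; exact: act_msub.
  have A'B : msub A' (B i).
    have one C : act 1 @^-1` C = C.
      by apply/seteqP; split=> x /=; rewrite act1.
    have := msub_trans (qA' _ (@U1 q)) (act_msub 1 (pA _ (@U1 p))).
    by rewrite !one.
  by apply: nmeager_msub (msubI A'B ghA') _; exact: open_nmeager.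
- exact: Pm.
by exists m => g h gU hU i im i0; exact: mP.
Qed.

(** Take [C] open and equal to the translate [g B i] up to a meager set: pulling a hit of [C] with
    itself by [x] back along [g] gives a hit of [B i] with itself by [x ^ g]. *)
Let UJ n g : exists m, forall x, U m x -> U n (x ^ g).
Proof.
have [i|i m m' mm' Pm i0 x /(U_anti mm')|m mP] := @U_bound
  (fun i m => B i !=set0 -> forall x, U m x -> hit (x ^ g) (B i) (B i)) n.
- have [i0|?] := pselect (B i !=set0); last by exists 0%N.
  have [C [oC C0 CB BC]] := translate g^-1 (B_open i) i0.
  have [m mC] := U_hit oC C0; exists m => _ x /mC xC.
  have := act_nmeager (g := g) xC; apply: nmeager_msub.
  rewrite preimage_setI pre_actM.
  have gC : msub (act g @^-1` C) (B i).
    have := act_msub g CB; rewrite pre_actM mulVg.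
    by rewrite (_ : act 1 @^-1` B i = B i)//; apply/seteqP; split=> y /=; rewrite act1.
  apply: msubI.
    by apply: msub_trans gC; apply: subset_msub; exact: subIsetl.
  apply: (@msub_trans _ _ (act (x * g) @^-1` C)).
    by apply: subset_msub; exact: subIsetr.
  by have := act_msub (x * g) CB; rewrite pre_actM.
- exact: Pm.
by exists m => x xU i im i0; exact: mP.
Qed.

Let ntop := ntopology U_anti.

(** A finite pattern [s] prescribes, for each [i] of small code, a base set that [B i] has to hit.
    There are countably many patterns; one group element is chosen for each realizable pattern. *)
Let U_separable : exists2 D : set G, countable D &
  forall n g, exists2 d, D d & U n (g^-1 * d).
Proof.
pose Q (s : seq (option (pidx b))) (g : G) :=
  forall i, (pickle i < size s)%N -> B i !=set0 ->
  exists2 l, nth None s (pickle i) = Some l & hit g (B i) (B l).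
have /choice[p pP] s : exists p, (exists g, Q s g) -> Q s p.
  by have [[g sg]|?] := pselect (exists g, Q s g); [exists g|exists 1].
exists (range p) => [|n g].
  by apply: card_le_trans (card_image_le _ _) _; exact: countableP.
have /choice[l lP] i : exists l, B i !=set0 ->
    B l !=set0 /\ msub (B l) (act g^-1 @^-1` B i).
  have [i0|?] := pselect (B i !=set0); last by exists i.
  by have [l l0 lB] := translate_base g^-1 (B_open i) i0; exists l.
(* The pattern realized by [g]: [B (l i)] is almost inside [g B i]. Entries at positions that are
   not codes are [None]. *)
pose s := mkseq (fun m => omap l (@pickle_inv (pidx b) m)) n.
have sQ h : Q s h <-> forall i, (pickle i < n)%N -> B i !=set0 ->
    hit h (B i) (B (l i)).
  split=> hQ i; rewrite ?size_mkseq => im i0.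
    have [|l'] := hQ i _ i0; first by rewrite size_mkseq.
    by rewrite nth_mkseq//= pickleK_inv => -[<-].
  by exists (l i); rewrite ?nth_mkseq//= ?pickleK_inv//; exact: hQ.
exists (p s); first by exists s.
have /sQ psQ : Q s (p s).
  apply: pP; exists g; apply/sQ => i _ i0; have [l0 lB] := lP i i0.
  rewrite -(invgK g); apply: hit_inv; apply: nmeager_msub (open_nmeager (B_open _) l0).
  by apply: msubI => //; exact: msubxx.
by move=> i im i0; have [_ lB] := lP i i0; apply: (hit_translate lB); exact: psQ.
Qed.

(* [j] is continuous on a comeager set when [G] carries the topology of the
   [U n]. *)
Let Q_ex : exists Q, meager (~` Q) /\ forall x n, Q x -> exists O,
  [/\ open O, O x & forall x', O x' -> Q x' -> U n ((j x)^-1 * j x')].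
Proof.
have /choice[O OP] l : exists O : set (X * X), [/\ open O,
    msub [set xy | B l (act (j xy.1) xy.2)] O &
    msub O [set xy | B l (act (j xy.1) xy.2)]] by exact: mul_mbaire.
pose Q := [set x | forall l,
  meager [set y | B l (act (j x) y) /\ ~ O l (x, y)] /\
  meager [set y | O l (x, y) /\ ~ B l (act (j x) y)]].
exists Q; split.
  apply: meagerS (meager_bigcup (I := pidx b) (P := setT)
    (fun l _ => meagerU (kuratowski_ulam b (let: And3 _ h _ := OP l in h))
                        (kuratowski_ulam b (let: And3 _ _ h := OP l in h)))).
  by move=> x /existsNP[l /not_andP nl]; exists l.
(* For [x] in [Q] the sections at [x] agree with those of the open [O l] up to meager sets; hitting
   thus becomes an open condition on [x]. *)
have hitE x i l : Q x -> hit (j x) (B i) (B l) <-> exists2 y, B i y & O l (x, y).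
  move=> /(_ l)[m1 m2]; split=> [h|[y iy Oy] mh].
    apply: contrapT => nex; apply: h; apply: meagerS m1 => y [iy ly].
    by split=> // Oy; apply: nex; exists y.
  have [oO _ _] := OP l; have [V [W [oV oW Vx Wy VW]]] := open_rect oO Oy.
  apply: (open_nmeager (openI (B_open i) oW)); first by exists y.
  apply: meagerS (meagerU mh m2) => z [iz Wz].
  have [lz|lz] := pselect (B l (act (j x) z)); first by left.
  by right; split=> //; exact: VW.
move=> x n Qx.
suff : nbhs x [set x' | forall i, (pickle i < n)%N -> Q x' -> B i !=set0 ->
    hit ((j x)^-1 * j x') (B i) (B i)].
  rewrite nbhsE => -[V [oV Vx] VU]; exists V; split=> // x' Vx' Qx' i im.
  exact: VU.
apply: filter_pickle_lt => i.
have [i0|i0] := pselect (B i !=set0); last by apply: filterS filterT => x' _ _ /i0.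
have [l l0 lB] := translate_base (j x)^-1 (B_open i) i0.
have : hit (j x) (B i) (B l).
  rewrite -(invgK (j x)); apply: hit_inv.
  apply: nmeager_msub (open_nmeager (B_open _) l0).
  by apply: msubI => //; exact: msubxx.
move=> /hitE-/(_ Qx)[y iy Oy].
have [oO _ _] := OP l; have [V [W [oV oW Vx Wy VW]]] := open_rect oO Oy.
rewrite nbhsE; exists V => // x' Vx' Qx' _.
by apply: (hit_translate lB); apply/hitE => //; exists y => //; exact: VW.
Qed.

(** The union of the base sets almost inside [Y] is open, dense by the hypothesis, and itself almost
    inside [Y] because the base is countable. *)
Let comeager_local (Y : set X) :
  (forall O, open O -> O !=set0 -> exists C,
    [/\ open C, C !=set0, msub C O & msub C Y]) -> meager (~` Y).
Proof.
move=> Yloc; pose V := \bigcup_(i in [set i | msub (B i) Y]) B i.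
have VY : msub V Y by exact: msub_bigcup.
have mV : meager (~` V).
  exists (fun=> V); split; last by move=> x /(_ 0%N Logic.I) Vx /(_ Vx).
  move=> _; split; first by apply: bigcup_open => i _.
  move=> O O0 oO; have [C [oC C0 CO CY]] := Yloc O oO O0.
  have [|x [[Ox _] Cx]] := msub_open_neq0 b (V := setT) oC C0 CO.
    by rewrite setDT; exact: meager0.
  have [i ix iOC] := pbase_sub b (openI oO oC) (conj Ox Cx).
  exists x; split=> //; exists i => //=; apply: msub_trans CY.
  by apply: subset_msub => y /iOC[].
apply: meagerS (meagerU mV VY) => x nYx.
by have [Vx|] := pselect (V x); [right|left].
Qed.

(* For generic [a] the sequence [u n a] converges in [X]: its members eventually
   lie in arbitrarily small base sets, by the two Cauchy conditions. *)
Let U_complete (u : nat -> G) :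
  (forall n, exists N, forall p q, (N <= p)%N -> (N <= q)%N ->
    U n ((u p)^-1 * u q) /\ U n (u p * (u q)^-1)) ->
  exists x, forall n, exists N, forall p, (N <= p)%N -> U n (x^-1 * u p).
Proof.
move=> uC; have [Q [mQ Qj]] := Q_ex; have [E [oE EQ]] := mQ.
(* Asking for closures inside the dense open [E n] forces the limit into [Q], on which [j] is
   continuous. *)
pose Y n := [set a | exists i, [/\ psmall b n i, closure (B i) `<=` E n &
  exists N, forall p, (N <= p)%N -> B i (act (u p) a)]].
have mY n : meager (~` Y n).
  apply: comeager_local => O oO O0; have [oEn dE] := oE n.
  have [O' [m [oO' O'0 O'O]]] := U_key oO O0.
  have [M MU] := uC m.
  (* Up to meager sets, [B i] will lie in [u M O'] and [C] in [(u N)^-1 C1]. The Cauchy condition on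
     [(u N)^-1 * u M] then puts [C] inside [O], and the one on [u p * (u N)^-1] sends [C] into [B i]
     for all late [p]. *)
  have [C0 [oC0 C00 C0M _]] := translate (u M)^-1 oO' O'0.
  have [y [C0y Ey]] := dE _ C00 oC0.
  have [i [iy iE si]] := pbase_nbhs b n (openI oC0 oEn) (conj C0y Ey).
  have i0 : B i !=set0 by exists y.
  have [C1 [m' [oC1 C10 C1i]]] := U_key (B_open i) i0.
  have [N0 N0U] := uC m'; pose N := maxn M N0.
  have [C [oC C0' CN _]] := translate (u N) oC1 C10.
  exists C; split=> //.
    have iN : msub (B i) (act (u N)^-1 @^-1` O).
      apply: (@msub_trans _ _ C0).
        by apply: subset_msub => z /subset_closure/iE[].
      apply: msub_trans C0M _.
      have NMU : U m ((u N)^-1 * u M).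
        by have [] := MU N M (leq_maxl _ _) (leqnn _).
      have := act_msub (u M)^-1 (O'O _ NMU).
      by rewrite pre_actM mulgK.
    have C1B : msub C1 (B i).
      have := C1i _ (@U1 m'); rewrite (_ : act 1 @^-1` B i = B i)//.
      by apply/seteqP; split=> z /=; rewrite act1.
    have := msub_trans CN (act_msub (u N) (msub_trans C1B iN)).
    rewrite pre_actM mulVg (_ : act 1 @^-1` O = O)//.
    by apply/seteqP; split=> z /=; rewrite act1.
  have CB p : (N <= p)%N -> msub C (act (u p) @^-1` B i).
    move=> Np; apply: msub_trans CN _.
    have pNU : U m' (u p * (u N)^-1).
      by have [] := N0U p N (leq_trans (leq_maxr _ _) Np) (leq_maxr _ _).
    have := act_msub (u N) (C1i _ pNU).
    by rewrite pre_actM -mulgA mulVg mulg1.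
  have := @meager_bigcup _ nat [set p | (N <= p)%N]
    (fun p => C `\` act (u p) @^-1` B i) CB.
  apply: meagerS => a [Ca nYa]; apply: contrapT => nex; apply: nYa.
  exists i; split=> //; first by move=> z /iE[].
  exists N => p Np; apply: contrapT => nB; apply: nex; exists p => //.
have : meager (~` (\bigcap_n (Y n `&` act (u n) @^-1` Q))).
  rewrite setC_bigcap; apply: meager_bigcup => n _; rewrite setCI.
  by apply: meagerU; [exact: mY|exact: (act_meager (u n) mQ)].
move=> /(comeager_neq0 b (ex_intro _ (k 1) Logic.I))[a aP].
have /choice[v vP] n : exists i, [/\ psmall b n i, closure (B i) `<=` E n &
  exists N, forall p, (N <= p)%N -> B i (act (u p) a)].
  by have [] := aP n Logic.I.
have [||z zcl zP] := @pbase_completeW _ b v.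
- by move=> n; have [] := vP n.
- move=> n; have /choice[N NP] i : exists N, forall p, (N <= p)%N ->
      B (v i) (act (u p) a) by have [] := vP i.
  exists (act (u (\max_(i < n.+1) N i)%N) a) => i; rewrite -ltnS => im.
  by apply: NP; exact: (leq_bigmax (Ordinal im)).
have Qz : Q z.
  by apply: contrapT; apply: (EQ z) => n _; have [_ + _] := vP n; apply.
(* Since [u p * j a] approaches [j z], the limit must be this quotient; moving [j a] to the other
   side is a conjugation. *)
exists (j z * (j a)^-1) => n; have [m mU] := UJ n (j a)^-1.
have [O [oO Oz OU]] := Qj z m Qz.
have [M MO] := zP O oO Oz; have [_ _ [N NP]] := vP M.
exists N => p Np.
have : U m ((j z)^-1 * j (act (u p) a)).
  apply: OU; first by apply: (MO M) => //; apply: subset_closure; exact: NP.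
  by have [] := aP p Logic.I.
move=> /mU; rewrite j_act /conjg !invgM !invgK => h.
suff -> : j a * (j z)^-1 * u p = j a * ((j z)^-1 * (u p * j a) / j a) by [].
by rewrite !mulgA mulgK.
Qed.

Section Embedding.
Context (K : preTopologicalGroupType) (c : polish_base K) (i : G -> K).
Hypotheses (Kh : hausdorff_space K) (iI : injective i).
Hypothesis KM : continuous (fun x : K * K => x.1 * x.2).
Hypothesis KV : continuous (fun x : K => x^-1).
Hypothesis iM : forall x y, i (x * y) = i x * i y.
Hypothesis ij_mbaire : forall O, open O -> mbaire ((i \o j) @^-1` O).

Let i1 : i 1 = 1.
Proof. by apply: (mulgI (i 1)); rewrite -iM !mulg1. Qed.

Let iV g : i g^-1 = (i g)^-1.
Proof. by apply: (mulgI (i g)); rewrite -iM !mulgV. Qed.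

(* Pettis' argument. *)
Let i_cont1 (O : set K) : nbhs (1 : K) O -> exists n, forall g, U n g -> O (i g).
Proof.
move=> O1.
pose small := [set l | forall y y', pbase c l y -> pbase c l y' -> O (y * y'^-1)].
have cover (y : K) : exists2 l, small l & pbase c l y.
  have : nbhs (y, y) [set z : K * K | O (z.1 * z.2^-1)].
    have : {for (y, y), continuous (fun z : K * K => z.1 * z.2^-1)}.
      apply: (@continuous_comp _ _ _ (fun z : K * K => (z.1, z.2^-1))
        (fun z => z.1 * z.2)); last exact: KM.
      apply: cvg_pair => /=; first exact: cvg_fst.
      by apply: cvg_comp; [exact: cvg_snd|exact: KV].
    by move=> /(_ O) /=; rewrite mulgV; apply.
  rewrite nbhsE => -[V [oV Vy] VO].
  have [W [W' [oW oW' Wy W'y WW']]] := open_rect oV Vy.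
  have [l ly lW] := pbase_sub c (openI oW oW') (conj Wy W'y).
  exists l => // z z' /lW[? _] /lW[_ ?].
  by apply: (VO (z, z')); exact: WW'.
have [l [sl nl]] : exists l, small l /\ ~ meager ((i \o j) @^-1` pbase c l).
  apply: contrapT => nex.
  have : meager [set: X].
    apply: (@meagerS _ _ (\bigcup_(l in small) ((i \o j) @^-1` pbase c l))).
      by move=> x _; have [l ? ?] := cover (i (j x)); exists l.
    apply: meager_bigcup => l sl; apply: contrapT => nl; apply: nex.
    by exists l.
  by move=> /(baire b openT) X0; suff : set0 (k 1) by []; rewrite -X0.
have [A [oA A0 Al _]] := mbaire_nonmeager (ij_mbaire (pbase_open l)) nl.
have [n nA] := U_hit oA A0; exists n => g /nA gA.
have /set0P[x [/= x1]] : ((i \o j) @^-1` pbase c l) `&`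
    act g @^-1` ((i \o j) @^-1` pbase c l) != set0.
  by apply/eqP => e; apply: (hit_msub Al Al gA); rewrite e; exact: meager0.
rewrite /= j_act iM => x2.
by have := sl _ _ x2 x1; rewrite mulgK.
Qed.

(** The embedding [i] also provides separation: it is injective, continuous at the unit by
    [i_cont1], and [K] is Hausdorff, so the sets [U n] have only the unit in common. *)
Theorem category_group_polish (R : realType) :
  exists t : isOpenTopological G,
    polish_group R (topologized t) /\ continuous (i : topologized t -> K).
Proof.
exists ntop; split.
  apply: (@ntopology_polish G U U1 UV U_anti UM UJ _ U_separable U_complete).
  move=> g gU; apply: iI; rewrite i1; apply: contrapT => gn1.
  have [V [W [oV oW Vg W1 VW]]] := hausdorff_separate Kh gn1.
  have [n nW] := i_cont1 (open_nbhs_nbhs (conj oW W1)).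
  by apply: (VW _ Vg); exact: nW.
move=> g A gA; apply: (iffRL (@ntopology_nbhsP G U U1 U_anti UM g _)).
have [|n nA] := i_cont1 (O := [set y | A (i g * y)]).
  have : {for 1, continuous (fun y => i g * y)}.
    apply: (@continuous_comp _ _ _ (fun y : K => (i g, y)) (fun z => z.1 * z.2));
      last exact: KM.
    by apply: cvg_pair => //=; exact: cvg_cst.
  by move=> /(_ A) /=; rewrite mulg1; apply.
exists n => x /nA; rewrite /= iM iV mulgA mulgV mul1g; done.
Qed.

End Embedding.

End CategoryGroup.

(** * Analytic sets, open mappings and Borel sections *)

Section AnalyticBaire.
Context (P Y : topologicalType) (b : polish_base P) (c : polish_base Y).
Context (q : P -> Y).
Hypotheses (qc : continuous q) (Yh : hausdorff_space Y).

(** Kuratowski's operator, a closed set that contains [S] up to a meager set. *)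
Definition nonmeager_points (S : set Y) :=
  [set y | forall O, open O -> O y -> ~ meager (S `&` O)].

Lemma nonmeager_points_closed S : closed (nonmeager_points S).
Proof.
move=> y yS O oO Oy; have [z [Sz Oz]] := yS O (open_nbhs_nbhs (conj oO Oy)).
exact: Sz.
Qed.

Lemma msub_nonmeager_points S : msub S (nonmeager_points S).
Proof.
pose I := [set l | meager (S `&` pbase c l)].
apply: (@meagerS _ _ (\bigcup_(l in I) (S `&` pbase c l))); last exact: meager_bigcup.
move=> y [Sy /existsNP[O /not_implyP[oO /not_implyP[Oy /contrapT mO]]]].
have [l ly lO] := pbase_sub c oO Oy; exists l => //=.
by apply: meagerS mO => z [? /lO].
Qed.

(** The difference [E] is Borel. Were it nonmeager, it would contain almost all of an open [O]
    meeting [nonmeager_points S]; but [S] is meager in [O], being covered there by the complement of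
    [E] and the sets [F i] minus their nonmeager points. *)
Lemma nonmeager_points_bigcup (I : countType) (J : set I) (S : set Y)
    (F : I -> set Y) : S `<=` \bigcup_(i in J) F i ->
  msub (nonmeager_points S) (\bigcup_(i in J) nonmeager_points (F i)).
Proof.
move=> SF; pose E := nonmeager_points S `\` \bigcup_(i in J) nonmeager_points (F i).
have bnp A : borel (nonmeager_points A).
  rewrite -(setCK (nonmeager_points A)); apply: borelC; apply: borel_open.
  by apply: closed_openC; exact: nonmeager_points_closed.
have bE : mbaire E.
  apply: borel_mbaire; rewrite /E setDE; apply: borelI; first exact: bnp.
  by apply: borelC; apply: borel_bigcup => i _; exact: bnp.
apply: contrapT => nE; have [O [oO O0 OE _]] := mbaire_nonmeager bE nE.
have [|y [[[Sy _] _] Oy]] := msub_open_neq0 c (V := setT) oO O0 OE.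
  by rewrite setDT; exact: meager0.
apply: (Sy O oO Oy).
apply: meagerS (meagerU OE (meager_bigcup (P := J)
  (fun i _ => @msub_nonmeager_points (F i)))).
move=> z [Sz Oz]; have [i Ji Fz] := SF z Sz.
have [npz|npz] := pselect (nonmeager_points (F i) z); last by right; exists i.
by left; split=> // -[_]; apply; exists i.
Qed.

(* The Souslin scheme of the images of the base sets computes [q @` U] from the
   closed sets [nonmeager_points], up to a meager set. *)
Lemma image_open_mbaire (U : set P) : open U -> mbaire (q @` U).
Proof.
move=> oU; pose N i := nonmeager_points (q @` pbase b i).
pose sub n (V : set P) := [set i | closure (pbase b i) `<=` V /\ psmall b n i].
have mbad n (V : set P) : open V ->
    msub (nonmeager_points (q @` V)) (\bigcup_(i in sub n V) N i).
  move=> oV; apply: nonmeager_points_bigcup => _ [x Vx <-].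
  have [i [ix iV ni]] := pbase_nbhs b n oV Vx.
  by exists i => //; exists x.
apply: (@mbaire_eq _ (nonmeager_points (q @` U))).
- apply: (@meagerS _ _ ((nonmeager_points (q @` U) `\` \bigcup_(i in sub 0 U) N i)
    `|` \bigcup_(ni in [set: nat * pidx b])
          (N ni.2 `\` \bigcup_(i in sub ni.1.+1 (pbase b ni.2)) N i))).
    move=> y [Uy nUy]; apply: contrapT => /not_orP[good0 good]; apply: nUy.
    have [i0 [i0U si0] i0y] : (\bigcup_(i in sub 0 U) N i) y.
      by apply: contrapT => ?; apply: good0.
    have /choice[s sP] (ni : nat * pidx b) : exists i, N ni.2 y ->
        sub ni.1.+1 (pbase b ni.2) i /\ N i y.
      have [Ny|?] := pselect (N ni.2 y); last by exists i0.
      have : (\bigcup_(i in sub ni.1.+1 (pbase b ni.2)) N i) y.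
        by apply: contrapT => ?; apply: good; exists ni.
      by move=> [i ? ?]; exists i.
    pose u := fix u n := if n is m.+1 then s (m, u m) else i0.
    have uN n : N (u n) y by elim: n => //= n /(sP (n, _))[].
    have uP n : closure (pbase b (u n.+1)) `<=` pbase b (u n) /\
        psmall b n.+1 (u n.+1) by have [] := sP (n, u n) (uN n).
    have [| | |x xu xP] := @pbase_nested _ b u.
    + by case=> [|n] //; have [] := uP n.
    + by move=> n z /subset_closure; have [h _] := uP n; exact: h.
    (* [N (u n) y] makes the image of the base set nonmeager, so the base set itself is nonempty. *)
    + move=> n; apply: contrapT => /nonemptyPn u0.
      apply: (uN n setT openT Logic.I).
      by rewrite u0 image_set0 set0I; exact: meager0.
    exists x; first by apply: i0U; exact: xu 0.
    apply: contrapT => nqxy.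
    have [V [W [oV oW Vx Wy VW]]] := hausdorff_separate Yh nqxy.
    have [n nV] := xP (q @^-1` V) (open_comp (fun x _ => qc (x := x)) oV) Vx.
    apply: (uN n W oW Wy); apply: meagerS (@meager0 _) => z [[p up <-] Wz].
    by apply: (VW (q p)) => //; apply: (nV n) => //; exact: subset_closure.
  apply: meagerU; first exact: mbad.
  by apply: meager_bigcup => -[n i] _ /=; apply: mbad; exact: pbase_open.
- exact: msub_nonmeager_points.
- rewrite -(setCK (nonmeager_points _)); apply: mbaireC; apply: mbaire_open.
  by apply: closed_openC; exact: nonmeager_points_closed.
Qed.

End AnalyticBaire.

Lemma meager_preimage_homeo (S T : topologicalType) (f : S -> T) (g : T -> S) A :
  cancel f g -> cancel g f -> continuous f -> continuous g ->
  meager A -> meager (f @^-1` A).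
Proof.
move=> fK gK /continuousP fc /continuousP gc [D [oD DA]].
exists (fun n => f @^-1` D n); split; last by move=> x Dx Ax; exact: DA Ax.
move=> n; have [oDn dD] := oD n; split; first exact: fc.
move=> O [x Ox] oO; have [||y [Oy Dy]] := dD (g @^-1` O); last 1 first.
- by exists (g y); split; rewrite /= ?gK.
- by exists (f x); rewrite /= fK.
- exact: gc.
Qed.

(** * Effros' open mapping theorem for transitive actions *)

Section Effros.
Local Open Scope group_scope.
Context (A : preTopologicalGroupType) (Y : topologicalType).
Context (b : polish_base A) (c : polish_base Y).
Context (act : A -> Y -> Y).
Hypotheses (AM : continuous (fun x : A * A => x.1 * x.2)).
Hypotheses (AV : continuous (fun x : A => x^-1)).
Hypotheses (Yh : hausdorff_space Y).
Hypotheses (act1 : forall y, act 1 y = y).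
Hypotheses (actM : forall g h y, act (g * h) y = act g (act h y)).
Hypotheses (act_cont : forall g, continuous (act g)).
Hypotheses (orbit_cont : forall y, continuous (act^~ y)).
Hypotheses (act_trans : forall x y, exists g, act g x = y).

Let orbit (U : set A) y := act^~ y @` U.

Let div_nbhs (V : set A) (g : A) : nbhs (1 : A) V ->
  exists O, [/\ open O, O g & forall x y, O x -> O y -> V (x^-1 * y)].
Proof.
move=> V1; have : nbhs (g, g) [set z : A * A | V (z.1^-1 * z.2)].
  have : {for (g, g), continuous (fun z : A * A => z.1^-1 * z.2)}.
    apply: (@continuous_comp _ _ _ (fun z : A * A => (z.1^-1, z.2))
      (fun z => z.1 * z.2)); last exact: AM.
    apply: cvg_pair => /=; last exact: cvg_snd.
    by apply: cvg_comp; [exact: cvg_fst|exact: AV].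
  by move=> /(_ V) /=; rewrite mulVg; apply.
rewrite nbhsE => -[W [oW Wg] WV].
have [O [O' [oO oO' Og O'g OO']]] := open_rect oW Wg.
exists (O `&` O'); split; [exact: openI|by split|].
by move=> x y [Ox _] [_ O'y]; apply: (WV (x, y)); exact: OO'.
Qed.

(** By transitivity countably many small base sets have orbits covering [Y], so one orbit is
    nonmeager and almost contains an open set; translating back by the inverse of an element [g] of
    that base set brings it to [y]. *)
Let orbit_comeager (V : set A) (y : Y) : nbhs (1 : A) V ->
  exists O, [/\ open O, O y & msub O (orbit V y)].
Proof.
move=> V1.
pose small := [set l | forall x x', pbase b l x -> pbase b l x' -> V (x^-1 * x')].
have [l [sl nl]] : exists l, small l /\ ~ meager (orbit (pbase b l) y).
  apply: contrapT => nex; suff : meager [set: Y].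
    by move=> /(baire c openT) Y0; suff : set0 y by []; rewrite -Y0.
  apply: (@meagerS _ _ (\bigcup_(l in small) orbit (pbase b l) y)).
    move=> z _; have [g gy] := act_trans y z.
    have [O [oO Og OV]] := div_nbhs g V1.
    have [l lg lO] := pbase_sub b oO Og.
    by exists l; [move=> x x' /lO ? /lO; exact: OV|exists g].
  by apply: meager_bigcup => l sl; apply: contrapT => nl; apply: nex; exists l.
have bl : mbaire (orbit (pbase b l) y).
  by apply: (image_open_mbaire b c) => //; exact: pbase_open.
have [O [oO O0 Ol _]] := mbaire_nonmeager bl nl.
have [|_ [[[g lg <-] _] Og]] := msub_open_neq0 c (V := setT) oO O0 Ol.
  by rewrite setDT; exact: meager0.
exists (act g @^-1` O); split=> //.
  by apply: open_comp => // x _; exact: act_cont.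
have actK h : cancel (act h) (act h^-1) by move=> x; rewrite -actM mulVg act1.
have actKV h : cancel (act h^-1) (act h) by move=> x; rewrite -actM mulgV act1.
apply: meagerS (meager_preimage_homeo (actK g) (actKV g)
  (act_cont (g := g)) (act_cont (g := g^-1)) Ol).
move=> x [/= Ox nx]; split=> // -[h lh hx]; apply: nx.
by exists (g^-1 * h); [exact: sl|rewrite actM hx actK].
Qed.

(** Removes the meager exception: for [z] near [y] the orbits of [y] and [z] under [W] are both
    comeager near [z], hence share a point [g y = h z], and [z = h^-1 g y]. *)
Let orbit_nbhs (V : set A) (y : Y) : nbhs (1 : A) V -> nbhs y (orbit V y).
Proof.
move=> V1; have [W [oW W1 WV]] := div_nbhs 1 V1.
have nW := open_nbhs_nbhs (conj oW W1).
have [O [oO Oy OW]] := orbit_comeager y nW.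
rewrite nbhsE; exists O => // z Oz.
have [O' [oO' O'z O'W]] := orbit_comeager z nW.
have [|||_ [[[g Wg <-] [h Wh hz]] _]] :=
    @msub_open_neq0 _ c (O `&` O') (orbit W y) (orbit W z) (openI oO oO').
- by exists z.
- by apply: msub_trans OW; apply: subset_msub => x [].
- by apply: msub_trans O'W; apply: subset_msub => x [].
by exists (h^-1 * g); [exact: WV|rewrite actM -hz -actM mulVg act1].
Qed.

Theorem orbit_map_open (U : set A) (y : Y) : open U -> open (act^~ y @` U).
Proof.
move=> oU; rewrite openE => _ [g Ug <-].
have V1 : nbhs (1 : A) [set h | U (h * g)].
  have : {for 1, continuous (fun h => h * g)}.
    apply: (@continuous_comp _ _ _ (fun h : A => (h, g)) (fun z => z.1 * z.2));
      last exact: AM.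
    by apply: cvg_pair => //=; exact: cvg_cst.
  by move=> /(_ U) /=; rewrite mul1g; apply; exact: open_nbhs_nbhs.
apply: filterS (orbit_nbhs (act g y) V1) => _ [h Uhg <-].
by exists (h * g) => //; rewrite actM.
Qed.

End Effros.

(** * Borel sections of open continuous surjections *)

Section BorelSection.
Context (P Y : topologicalType) (b : polish_base P) (q : P -> Y).
Hypotheses (Yh : hausdorff_space Y) (qc : continuous q).
Hypotheses (qo : forall U, open U -> open (q @` U)).
Hypothesis q_surj : forall y, exists x, q x = y.

Let B (o : option (pidx b)) := oapp (pbase b) setT o.

Let fine n o i := closure (pbase b i) `<=` B o /\ psmall b n i.

Let least n o i y := [/\ fine n o i, (q @` pbase b i) y &
  forall i', fine n o i' -> (q @` pbase b i') y -> (pickle i <= pickle i')%N].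

(** Images of base sets are open, and minimality of the code only excludes countably many of
    them. *)
Let borel_least n o i : borel [set y | least n o i y].
Proof.
have [fi|nfi] := pselect (fine n o i); last first.
  by rewrite (_ : mkset _ = set0); [exact: sigma_algebra0|apply/seteqP; split=> y // -[]].
have bq i' : borel (q @` pbase b i').
  by apply: borel_open; apply: qo; exact: pbase_open.
rewrite (_ : mkset _ = q @` pbase b i `&`
  \bigcap_(i' in [set i' | fine n o i' /\ ~ (pickle i <= pickle i')%N])
    ~` (q @` pbase b i')).
  by apply: borelI => //; apply: borel_bigcap => i' _; exact: borelC.
apply/seteqP; split=> y.
  by move=> [_ yi yl]; split=> // i' [/yl h nle] /h.
by move=> [yi yl]; split=> // i' fi' yi'; apply: contrapT => nle; exact: (yl i').
Qed.

Let least_ex n o y : (q @` B o) y -> exists i, least n o i y.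
Proof.
have oB : open (B o) by case: o => [i|] /=; [exact: pbase_open|exact: openT].
move=> [x Bx xy]; have [i [ix iB ni]] := pbase_nbhs b n oB Bx.
pose p m := `[< exists2 i, pickle i = m & fine n o i /\ (q @` pbase b i) y >].
have pex : exists m, p m.
  by exists (pickle i); apply/asboolP; exists i => //; split=> //; exists x.
have [m /asboolP[k km [fk ky]] mmin] := ex_minnP pex.
exists k; split=> // i' fi' yi'; rewrite km; apply: mmin.
by apply/asboolP; exists i'.
Qed.

(** At each stage the base set of least code inside the previous one whose image still contains [y]
    is chosen, starting from the whole space, coded by [None]. These base sets shrink to [s y], and
    each choice depends on [y] in a Borel way. *)
Theorem borel_section : exists s, borel_fun s /\ forall y, q (s y) = y.
Proof.
(* An empty [Y] is treated apart, since a point is needed to obtain the default index [i0]. *)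
have [[y0]|Y0] := pselect (exists y : Y, True); last first.
  have s0 (y : Y) : P by exfalso; apply: Y0; exists y.
  exists s0; split=> [C _|y]; last by exfalso; apply: Y0; exists y.
  rewrite (_ : _ @^-1` _ = set0); first exact: sigma_algebra0.
  by apply/seteqP; split=> y _ //; apply: Y0; exists y.
have [|i0 _] := @least_ex 0 None y0.
  by have [x <-] := q_surj y0; exists x.
have /choice[sel selP] (p : nat * option (pidx b) * Y) : exists i,
    (q @` B p.1.2) p.2 -> least p.1.1 p.1.2 i p.2.
  have [/least_ex-/(_ p.1.1)[i ?]|?] := pselect ((q @` B p.1.2) p.2).
    by exists i.
  by exists i0.
pose u y := fix u n := if n is m.+1 then Some (sel (m, u m, y)) else None.
pose v y n := sel (n, u y n, y).
have uB y n : (q @` B (u y n)) y.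
  elim: n => [|n IH] /=; first by have [x <-] := q_surj y; exists x.
  by have [_ + _] := selP (n, u y n, y) IH.
have vP y n := selP (n, u y n, y) (uB y n).
have bu n o : borel [set y | u y n = o].
  elim: n o => [|n IH] [i|].
  - by rewrite (_ : mkset _ = set0); [exact: sigma_algebra0|apply/seteqP; split].
  - rewrite (_ : mkset _ = setT); last by apply/seteqP; split.
    by apply: borel_open; exact: openT.
  - rewrite (_ : mkset _ = \bigcup_o ([set y | u y n = o] `&` [set y | least n o i y])).
      by apply: borel_bigcup => o _; apply: borelI; [exact: IH|exact: borel_least].
    apply/seteqP; split=> y /=.
      by move=> [<-]; exists (u y n) => //; split=> //; exact: vP.
    move=> [o _ [/= uo [fi yi il]]]; congr Some; apply: (pcan_inj pickleK).
    have [fv yv vl] := vP y n; apply/eqP; rewrite eqn_leq; apply/andP; split.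
      by apply: vl => //; rewrite uo.
    by apply: il => //; rewrite -uo.
  - by rewrite (_ : mkset _ = set0); [exact: sigma_algebra0|apply/seteqP; split].
have /choice[s sP] y : exists x, (forall n, closure (pbase b (v y n)) x) /\
    forall U, open U -> U x ->
      exists n, forall m, (n <= m)%N -> closure (pbase b (v y m)) `<=` U.
  have [n|n z /subset_closure|n|x xv xU] := @pbase_nested _ b (v y).
  - by have [[]] := vP y n.
  - by have [[h _] _ _] := vP y n.+1; exact: h.
  - by have [_ [x ? _] _] := vP y n; exists x.
  by exists x.
exists s; split.
  apply: borel_funP => U oU.
  rewrite (_ : _ @^-1` _ = \bigcup_(ni in [set ni : nat * pidx b |
      closure (pbase b ni.2) `<=` U]) [set y | u y ni.1.+1 = Some ni.2]).
    by apply: borel_bigcup => ni _; exact: bu.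
  apply/seteqP; split=> y /=.
    move=> Usy; have [_ /(_ U oU Usy)[n nU]] := sP y.
    by exists (n, v y n) => //=; exact: nU.
  move=> [[n i] /= iU [vi]]; apply: iU; rewrite -vi.
  by have [h _] := sP y; exact: h.
move=> y; apply: contrapT => nqsy.
have [V [W [oV oW Vx Wy VW]]] := hausdorff_separate Yh nqsy.
have [_ /(_ _ (open_comp (fun x _ => qc (x := x)) oV) Vx)[n nV]] := sP y.
have [_ [x xv /= xy] _] := vP y n.
apply: (VW y) => //; rewrite -xy.
by apply: (nV n) => //; exact: subset_closure.
Qed.

End BorelSection.

Local Open Scope group_scope.

(** * Polish groups and homomorphisms between groups with a Polish cover *)

Lemma continuous_fst (S T : topologicalType) : continuous (@fst S T).
Proof. by move=> x; exact: cvg_fst. Qed.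

Lemma continuous_snd (S T : topologicalType) : continuous (@snd S T).
Proof. by move=> x; exact: cvg_snd. Qed.

Lemma continuous_compT (S T U : topologicalType) (f : S -> T) (g : T -> U) :
  continuous f -> continuous g -> continuous (g \o f).
Proof. by move=> fc gc x; apply: continuous_comp; [exact: fc|exact: gc]. Qed.

Lemma continuous_pair (S T U : topologicalType) (f : S -> T) (g : S -> U) :
  continuous f -> continuous g -> continuous (fun x => (f x, g x)).
Proof. by move=> fc gc x; apply: cvg_pair; [exact: fc|exact: gc]. Qed.

Section GroupContinuity.
Context (G : preTopologicalGroupType) (T : topologicalType).
Hypothesis GM : continuous (fun x : G * G => x.1 * x.2).
Implicit Types f g : T -> G.

Lemma continuous_mulg f g : continuous f -> continuous g ->
  continuous (fun x => f x * g x).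
Proof.
move=> fc gc x.
by apply: (@continuous_comp _ _ _ (fun x => (f x, g x)) (fun x => x.1 * x.2));
  [exact: continuous_pair|exact: GM].
Qed.

Lemma borel_fun_mulg (b : polish_base G) f g : borel_fun f -> borel_fun g ->
  borel_fun (fun x => f x * g x).
Proof.
move=> bf bg; apply: (borel_fun_comp (f := fun x => (f x, g x))
  (g := fun x : G * G => x.1 * x.2)); first exact: borel_fun_pair.
exact: borel_fun_continuous.
Qed.

End GroupContinuity.

Lemma continuous_mulg_prod (G H : preTopologicalGroupType) :
  continuous (fun x : G * G => x.1 * x.2) ->
  continuous (fun x : H * H => x.1 * x.2) ->
  continuous (fun x : (G * H) * (G * H) => x.1 * x.2).
Proof.
move=> GM HM; pose P := (G * H * (G * H))%type.
have c1 : continuous (fst : P -> G * H) by exact: continuous_fst.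
have c2 : continuous (snd : P -> G * H) by exact: continuous_snd.
apply: (continuous_pair (f := fun x : P => x.1.1 * x.2.1)
  (g := fun x : P => x.1.2 * x.2.2)); apply: continuous_mulg => //.
- exact: continuous_compT c1 (@continuous_fst G H).
- exact: continuous_compT c2 (@continuous_fst G H).
- exact: continuous_compT c1 (@continuous_snd G H).
- exact: continuous_compT c2 (@continuous_snd G H).
Qed.

Lemma continuous_invg_prod (G H : preTopologicalGroupType) :
  continuous (fun x : G => x^-1) -> continuous (fun x : H => x^-1) ->
  continuous (fun x : G * H => x^-1).
Proof.
move=> GV HV; apply: (continuous_pair (f := fun x : G * H => x.1^-1)
  (g := fun x : G * H => x.2^-1)).
  exact: (continuous_compT (@continuous_fst G H)).
exact: (continuous_compT (@continuous_snd G H)).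
Qed.

Lemma continuous_initial (S : choiceType) (T U : topologicalType) (e : S -> T)
    (f : U -> initial_topology e) : continuous (e \o f) -> continuous f.
Proof.
by move=> /continuousP efc; apply/continuousP => _ [O oO <-]; exact: efc.
Qed.

Section ClosedEmbedding.
Context (R : realType) (L : groupType) (K : preTopologicalGroupType).
Context (c : polish_base K) (e : L -> K).
Hypotheses (Kh : hausdorff_space K) (eI : injective e).
Hypothesis KM : continuous (fun x : K * K => x.1 * x.2).
Hypothesis KV : continuous (fun x : K => x^-1).
Hypothesis eM : forall x y, e (x * y) = e x * e y.
Hypothesis e_closed : forall x,
  (forall U, open U -> U x -> exists s, U (e s)) -> exists s, e s = x.

(** The category construction applied to [L] with its induced topology and [j] the identity:
    translations are homeomorphisms and all operations continuous, so its hypotheses are immediate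
    and no complete metric on [L] has to be exhibited. *)
Lemma closed_subgroup_polish : exists t : isOpenTopological L,
  polish_group R (topologized t) /\ continuous (e : topologized t -> K).
Proof.
pose X := initial_topology e; pose mulX (x y : X) : X := x * y : L.
have ec : continuous (e : X -> K) by exact: initial_continuous.
have e1 : e 1 = 1 by apply: (mulgI (e 1)); rewrite -eM !mulg1.
have eV x : e x^-1 = (e x)^-1 by apply: (mulgI (e x)); rewrite -eM !mulgV.
have mulc : continuous (fun x : X * X => mulX x.1 x.2).
  apply: continuous_initial.
  rewrite (_ : _ \o _ = fun x : X * X => e x.1 * e x.2); last first.
    by apply/funext => x /=; rewrite eM.
  apply: continuous_mulg => //.
    exact: (continuous_compT (@continuous_fst X X)).
  exact: (continuous_compT (@continuous_snd X X)).
have invc : continuous (fun x : X => x^-1 : X).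
  apply: continuous_initial.
  rewrite (_ : _ \o _ = (fun z => z^-1) \o (e : X -> K)).
    exact: continuous_compT.
  by apply/funext => x /=; rewrite eV.
have actc g : continuous (mulX g).
  apply: (continuous_compT (f := fun x : X => (g : X, x))
    (g := fun x : X * X => mulX x.1 x.2)) => //.
  by apply: continuous_pair; [exact: cst_continuous|move=> x; exact: cvg_id].
have divc : continuous (fun x : X * X => mulX x.1^-1 x.2).
  apply: (continuous_compT (f := fun x : X * X => (x.1^-1 : X, x.2))
    (g := fun x : X * X => mulX x.1 x.2)) => //.
  apply: continuous_pair; last exact: continuous_snd.
  exact: (continuous_compT (@continuous_fst X X)).
have open_pre (S T : topologicalType) (f : S -> T) U :
    continuous f -> open U -> mbaire (f @^-1` U).
  by move=> /continuousP fc oU; apply: mbaire_open; exact: fc.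
apply: (@category_group_polish L X (polish_base_initial c e_closed) id id mulX
  _ _ _ _ _ _ K c e) => //.
- move=> g A; apply: (@meager_preimage_homeo _ _ (mulX g) (mulX g^-1)) => //.
  + by move=> x; exact: mulKg.
  + by move=> x; exact: mulVKg.
- by move=> g U oU; exact: open_pre.
- by move=> U oU; exact: (open_pre _ _ _ _ mulc).
- by move=> U oU; exact: (open_pre _ _ _ _ divc).
- by move=> O oO; exact: (open_pre _ _ _ _ ec).
Qed.

End ClosedEmbedding.

Lemma hausdorff_prod (S T : topologicalType) :
  hausdorff_space S -> hausdorff_space T -> hausdorff_space (S * T)%type.
Proof.
move=> Sh Th [x y] [x' y'] c; congr pair; [apply: Sh|apply: Th] => A B nA nB.
  have [||[a d] [/= Aa Ba]] := c (fst @^-1` A) (fst @^-1` B).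
  - exact: (@continuous_fst S T (x, y) A nA).
  - exact: (@continuous_fst S T (x', y') B nB).
  by exists a.
have [||[d a] [/= Aa Ba]] := c (snd @^-1` A) (snd @^-1` B).
- exact: (@continuous_snd S T (x, y) A nA).
- exact: (@continuous_snd S T (x', y') B nB).
by exists a.
Qed.

Lemma polish_group_base (R : realType) (G : preTopologicalGroupType) :
  polish_group R G -> polish_base G.
Proof. by move=> GP; apply: (@polish_space_base R); case: GP. Qed.

Lemma polish_group_hausdorff (R : realType) (G : preTopologicalGroupType) :
  polish_group R G -> hausdorff_space G.
Proof. by move=> [_ _]; exact: polish_space_hausdorff. Qed.

Section Cosets.
Context (R : realType) (X : polishCover R).
Implicit Types g h : cover_group X.

Lemma eq_coverpi g h : coverpi g = coverpi h <-> g^-1 * h \in cover_kernel X.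
Proof. by rewrite -eq_cosetg; split=> /eqP. Qed.

Lemma coverpi_surj (u : coverq X) : exists g, coverpi g = u.
Proof. by exists (repr u); exact: cosetg_surj. Qed.

End Cosets.

(** * From a Borel lift to a Polish lifted graph *)

Section BorelLift.
Context (R : realType) (X Y : polishCover R).
Context (phi : {multiplicative coverq X -> coverq Y}).
Context (f : cover_group X -> cover_group Y).
Hypotheses (f_lift : is_lift phi f) (f_borel : borel_fun f).

Let G := cover_group X.
Let H := cover_group Y.
Let Gamma := subgroup_type (lifted_graph_group phi).

Let GP : polish_group R G. Proof. exact: polish_groupP. Qed.
Let HP : polish_group R H. Proof. exact: polish_groupP. Qed.
Let bG : polish_base G := polish_group_base GP.
Let bH : polish_base H := polish_group_base HP.
Let GM : continuous (fun x : G * G => x.1 * x.2). Proof. by case: GP. Qed.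
Let HM : continuous (fun x : H * H => x.1 * x.2). Proof. by case: HP. Qed.
Let GV : continuous (fun x : G => x^-1). Proof. by case: GP. Qed.
Let HV : continuous (fun x : H => x^-1). Proof. by case: HP. Qed.

Context (t : isOpenTopological (subgroup_type (cover_kernel Y))).
Let M := topologized t.
Hypotheses (MP : polish_group R M) (val_cont : continuous (val : M -> H)).
Let bM : polish_base M := polish_group_base MP.
Let MM : continuous (fun x : M * M => x.1 * x.2). Proof. by case: MP. Qed.

Let lift_graph (y : G) (m : M) : (y, f y * val m) \in lifted_graph_group phi.
Proof.
rewrite unfold_in /=; apply/eqP; rewrite /= f_lift.
by apply/eq_coverpi; rewrite mulKg; exact: (valP m).
Qed.

Let graph_kernel (z : Gamma) : (f (val z).1)^-1 * (val z).2 \in cover_kernel Y.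
Proof.
by apply/eq_coverpi; rewrite -f_lift; have := valP z; rewrite unfold_in => /eqP.
Qed.

Let j (x : G * M) : Gamma := exist (fun z => z \in lifted_graph_group phi) _ (lift_graph x.1 x.2).
Let k (z : Gamma) : G * M := 
  ((val z).1, exist (fun h => h \in cover_kernel Y) _ (graph_kernel z)).

Let jK : cancel j k.
Proof.
by move=> [y m]; congr pair; apply: val_inj; rewrite /= mulKg.
Qed.

Let kK : cancel k j.
Proof. by move=> z; apply: val_inj; rewrite /= mulVKg; case: (val z). Qed.

Let act (z : Gamma) (x : G * M) : G * M := k (z * j x).

Let val_act2 z x : val (act z x).2 =
  (f ((val z).1 * x.1))^-1 * ((val z).2 * (f x.1 * val x.2)).
Proof. by []. Qed.

(** The second component of [k] is given by a Borel formula in [H]; [borel_fun_corestrict] makes it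
    Borel for the finer topology of [M]. *)
Let k_borel (S : topologicalType) (F : S -> Gamma) :
  borel_fun (fun s => (val (F s)).1) -> borel_fun (fun s => (val (F s)).2) ->
  borel_fun (k \o F).
Proof.
move=> b1 b2; apply: (borel_fun_pair bG bM) => //.
apply: (borel_fun_corestrict (i := val : M -> H) bM) => //.
- exact: polish_group_hausdorff HP.
apply: borel_fun_mulg => //.
apply: (borel_fun_comp (g := fun x : H => x^-1)); last exact: borel_fun_continuous.
exact: borel_fun_comp f_borel.
Qed.

Let j_borel2 (S : topologicalType) (F : S -> G * M) : continuous F ->
  borel_fun (fun s => (val (j (F s))).2).
Proof.
move=> Fc; apply: borel_fun_mulg => //.
  apply: (borel_fun_comp (f := fun s => (F s).1)) => //.
  apply: borel_fun_continuous; exact: continuous_compT (@continuous_fst _ _).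
apply: borel_fun_continuous.
apply: (continuous_compT (f := fun s => (F s).2)) => //.
exact: continuous_compT (@continuous_snd _ _).
Qed.

Let act_borel z : borel_fun (act z).
Proof.
apply: k_borel => /=.
  apply: borel_fun_continuous; apply: continuous_mulg => //.
    exact: cst_continuous.
  exact: continuous_fst.
apply: borel_fun_mulg => //.
  by apply: borel_fun_continuous; exact: cst_continuous.
by apply: (j_borel2 (F := id)) => x; exact: cvg_id.
Qed.

Let mul_borel : borel_fun (fun x : (G * M) * (G * M) => act (j x.1) x.2).
Proof.
apply: k_borel => /=.
  apply: borel_fun_continuous; apply: continuous_mulg => //.
    exact: continuous_compT (@continuous_fst _ _) (@continuous_fst _ _).
  exact: continuous_compT (@continuous_snd _ _) (@continuous_fst _ _).
apply: borel_fun_mulg => //.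
  exact: (j_borel2 (@continuous_fst _ _)).
exact: (j_borel2 (@continuous_snd _ _)).
Qed.

Let div_borel : borel_fun (fun x : (G * M) * (G * M) => act (j x.1)^-1 x.2).
Proof.
apply: k_borel => /=.
  apply: borel_fun_continuous; apply: continuous_mulg => //.
    apply: (continuous_compT (g := fun x : G => x^-1)) => //.
    exact: continuous_compT (@continuous_fst _ _) (@continuous_fst _ _).
  exact: continuous_compT (@continuous_snd _ _) (@continuous_fst _ _).
apply: borel_fun_mulg => //; last exact: (j_borel2 (@continuous_snd _ _)).
apply: (borel_fun_comp (g := fun x : H => x^-1)); last exact: borel_fun_continuous.
exact: (j_borel2 (@continuous_fst _ _)).
Qed.

(* [act z] is a skew product of a translation of [G] and translations of [M]. *)
Let act_meager z A : meager A -> meager (act z @^-1` A).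
Proof.
(* A Borel meager set containing [A]: the converse of Kuratowski-Ulam needs the Baire property of
   the preimage. *)
move=> [D [oD DA]]; pose A' := ~` \bigcap_n D n.
have mA' : meager A' by exists D; split=> // x Dx; apply; exact: Dx.
apply: (@meagerS _ _ (act z @^-1` A')); first by move=> x Ax Dx; exact: DA Ax.
apply: (kuratowski_ulam_converse bM bG).
  apply: borel_mbaire; apply: act_borel; apply: borelC.
  by apply: borel_bigcap => n _; apply: borel_open; have [] := oD n.
have := kuratowski_ulam bM mA'.
have mulG g : continuous (fun y : G => g * y).
  by apply: continuous_mulg => // y; [exact: cst_continuous|exact: cvg_id].
have mulM m : continuous (fun y : M => m * y : M).
  apply: (@continuous_mulg M) => //; first exact: cst_continuous.
  by move=> y; exact: cvg_id.
move=> /(@meager_preimage_homeo G G (fun y => (val z).1 * y)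
  (fun y => (val z).1^-1 * y) _ (mulKg _) (mulVKg _) (@mulG _) (@mulG _)).
apply: meagerS => y ny mA'y; apply: ny.
(* Over a fixed [y], [act z] multiplies the second coordinate on the left by [m], which is
   [f (z1 y)^-1 z2 (f y)] for [z = (z1, z2)]. *)
pose m : M := (act z (y, 1)).2.
have := @meager_preimage_homeo M M (fun x => m * x) (fun x => m^-1 * x) _
  (mulKg _) (mulVKg _) (@mulM _) (@mulM _) mA'y.
apply: meagerS => x /=; rewrite (_ : act z (y, x) = ((val z).1 * y, m * x))//.
congr pair; apply: val_inj; rewrite val_act2.
have -> : val (m * x) = val m * val x by [].
by rewrite val_act2 /= mulg1 !mulgA.
Qed.

Lemma borel_lift_polish_cover_hom : polish_cover_hom phi.
Proof.
have bGH := polish_base_prod bG bH.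
apply: (@category_group_polish Gamma (G * M)%type (polish_base_prod bG bM)
  j k act jK _ act_meager _ _ _ (G * H)%type bGH val) => //.
- by move=> z x; exact: kK.
- by move=> z U oU; exact: borel_fun_mbaire (act_borel z) oU.
- by move=> U oU; exact: borel_fun_mbaire mul_borel oU.
- by move=> U oU; exact: borel_fun_mbaire div_borel oU.
- by apply: hausdorff_prod; exact: (@polish_group_hausdorff R).
- exact: continuous_mulg_prod.
- exact: continuous_invg_prod.
- move=> O oO; apply: borel_fun_mbaire => //.
  apply: (borel_fun_pair bG bH (f := fst)).
    by apply: borel_fun_continuous; exact: continuous_fst.
  by apply: (j_borel2 (F := id)) => x; exact: cvg_id.
Qed.

End BorelLift.

(* The preimage is the fibre product of [G] and [M] over [K]. *)
Lemma polish_subgroup_preimage (R : realType) (G K : preTopologicalGroupType)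
    (p : G -> K) (L : groupClosed G) (M : groupClosed K) :
  polish_group R G -> hausdorff_space K -> continuous p ->
  {morph p : x y / x * y} -> (forall x, (x \in L) = (p x \in M)) ->
  polish_subgroup R M -> polish_subgroup R L.
Proof.
move=> GP Kh pc pM LM [u [MP val_contM]]; pose M' := topologized u.
have kerP (x : subgroup_type L) : p (val x) \in M by rewrite -LM; exact: (valP x).
pose e2 (x : subgroup_type L) : subgroup_type M :=
  exist (fun g => g \in M) _ (kerP x).
have e2M x y : e2 (x * y) = e2 x * e2 y.
  by apply: val_inj; rewrite -[LHS]/(p (val x * val y)) pM.
have [GM GV _] := GP; have [MM MV _] := MP.
have [||||||v [vP vc]] := @closed_subgroup_polish R (subgroup_type L)
    (G * M')%type
    (polish_base_prod (polish_group_base GP) (polish_group_base MP))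
    (fun x => (val x, e2 x)).
- by apply: hausdorff_prod; exact: (@polish_group_hausdorff R).
- by move=> x y [xy _]; exact: val_inj.
- exact: continuous_mulg_prod.
- exact: continuous_invg_prod.
- by move=> x y; rewrite e2M.
(* [L] need not be closed in [G], but its copy in [G * M'] is: it is the set where two continuous
   maps into the Hausdorff [K] agree. *)
- move=> [z n] zn.
  have zn1 : p z = val n.
    apply: contrapT => /(hausdorff_separate Kh)[V [W [oV oW Vz Wn VW]]].
    have [||s [Vs Ws]] := zn ((p @^-1` V) `*` ((val : M' -> K) @^-1` W)).
    + by apply: open_setX; apply: open_comp.
    + by [].
    by apply: VW Vs _.
  have zL : z \in L by rewrite LM zn1; exact: (valP n).
  by exists (exist (fun z => z \in L) z zL); congr pair; exact: val_inj.
by exists v; split=> //; exact: continuous_compT vc (@continuous_fst _ _).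
Qed.

Section QuotientLift.
Context (R : realType) (X Y : polishCover R).
Context (f : {multiplicative cover_group X -> cover_group Y}).
Hypothesis f_kernel : forall x, x \in cover_kernel X -> f x \in cover_kernel Y.

Let lift (u : coverq X) : coverq Y := coverpi (f (repr u)).

Let liftE x : lift (coverpi x) = coverpi (f x).
Proof.
have f1 : f 1 = 1 by apply: (mulgI (f 1)); rewrite -gmulfM !mulg1.
have fV y : f y^-1 = (f y)^-1.
  by apply: (mulgI (f y)); rewrite -gmulfM !mulgV.
apply/eq_coverpi; rewrite -fV -gmulfM; apply: f_kernel.
by apply/eq_coverpi; exact: cosetg_surj.
Qed.

Let liftM : {morph lift : u v / u * v}.
Proof.
move=> u v; have [x <-] := coverpi_surj u; have [y <-] := coverpi_surj v.
have -> : coverpi x * coverpi y = coverpi (x * y) by rewrite gmulfM.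
by rewrite !liftE !gmulfM.
Qed.

Lemma quotient_lift : exists psi : {multiplicative coverq X -> coverq Y},
  is_lift psi f.
Proof.
pose psi : {multiplicative coverq X -> coverq Y} :=
  HB.pack lift (isMultiplicative.Build _ _ lift liftM).
by exists psi => x; rewrite -[LHS]/(lift (coverpi x)) liftE.
Qed.

End QuotientLift.

(** * From a Polish lifted graph to a factorization *)

Section GraphCover.
Context (R : realType) (X Y : polishCover R).
Context (phi : {multiplicative coverq X -> coverq Y}).

Let G := cover_group X.
Let H := cover_group Y.
Context (t : isOpenTopological (subgroup_type (lifted_graph_group phi))).
Let Gamma := topologized t.
Hypothesis GammaP : polish_group R Gamma.
Hypothesis val_cont : continuous (val : Gamma -> (G * H)%type).

Let phi1 : phi 1 = 1.
Proof. by apply: (mulgI (phi 1)); rewrite -gmulfM !mulg1. Qed.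

Let graphP (z : Gamma) : phi (coverpi (val z).1) = coverpi (val z).2.
Proof. by have := valP z; rewrite unfold_in => /eqP. Qed.

Let L : {pred Gamma} := fun z => (val z).1 \in cover_kernel X.

Let L_closed : group_closed L.
Proof.
split=> [|x y]; first exact: gpred1.
by move=> xN yN; exact: (@gpredF _ (cover_kernel X) (val x).1 (val y).1 xN yN).
Qed.

Let L_conj x g : x \in L -> x ^ g \in L.
Proof. by move=> xN; exact: (@gpredJl _ (cover_kernel X) (val x).1 (val g).1 xN). Qed.

Let LJ : normalClosed Gamma :=
  HB.pack L (isMul1Closed.Build Gamma L L_closed.1)
    (isMulClosed.Build Gamma L (group_closedM L_closed))
    (isInvClosed.Build Gamma L (group_closedV L_closed))
    (isConjgClosed.Build Gamma L L_conj).

Let Z0 : polishGroupType R := HB.pack (topologized t)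
  (PreTopologicalGroup_isPolish.Build R (topologized t) GammaP).

Let L_polish : @polish_subgroup R Z0 LJ.
Proof.
apply: (@polish_subgroup_preimage R Z0 G (fun z : Gamma => (val z).1) LJ
  (cover_kernel X)) => //.
- by apply: (@polish_group_hausdorff R); exact: polish_groupP.
- exact: continuous_compT val_cont (@continuous_fst _ _).
- exact: cover_kernel_polish.
Qed.

Let Z : polishCover R := @PolishCover R Z0 LJ L_polish.

Let proj1M : {morph (fun z : Z0 => (val z).1 : G) : x y / x * y}.
Proof. by []. Qed.

Let proj2M : {morph (fun z : Z0 => (val z).2 : H) : x y / x * y}.
Proof. by []. Qed.

(** [rho] is injective because [L] is the full preimage of the kernel, not just a part of it, and
    surjective because every value of [phi] has a representative. *)
Lemma graph_cover : exists (Z : polishCover R)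
    (psi : {multiplicative coverq Z -> coverq Y})
    (rho : {multiplicative coverq Z -> coverq X})
    (rhoV : coverq X -> coverq Z),
  [/\ airomorphism psi, airomorphism rho,
      cancel rho rhoV, cancel rhoV rho & phi =1 psi \o rhoV].
Proof.
pose p1 : {multiplicative cover_group Z -> cover_group X} :=
  HB.pack (fun z : Z0 => (val z).1 : G) (isMultiplicative.Build _ _ _ proj1M).
pose p2 : {multiplicative cover_group Z -> cover_group Y} :=
  HB.pack (fun z : Z0 => (val z).2 : H) (isMultiplicative.Build _ _ _ proj2M).
have p1c : continuous p1 by exact: continuous_compT val_cont (@continuous_fst _ _).
have p2c : continuous p2 by exact: continuous_compT val_cont (@continuous_snd _ _).
have p12 (z : cover_group Z) : phi (coverpi (p1 z)) = coverpi (p2 z).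
  exact: graphP.
have [|rho rhoE] := @quotient_lift R Z X p1; first by [].
have [|psi psiE] := @quotient_lift R Z Y p2.
  (* Membership in the kernel becomes an equality of cosets: the first coordinate of [z] has the
     trivial coset, hence so does the second, through [phi]. *)
  move=> z zL; rewrite -(mul1g (p2 z)) -invg1; apply/eq_coverpi.
  rewrite -p12 -(_ : coverpi 1 = coverpi (p1 z)).
    by rewrite [X in phi X]gmulf1 phi1 gmulf1.
  by apply/eq_coverpi; rewrite invg1 mul1g.
have rho_inj : injective rho.
  move=> u v; have [x <-] := coverpi_surj u; have [y <-] := coverpi_surj v.
  by rewrite !rhoE => /eq_coverpi xy; apply/eq_coverpi.
have /choice[rhoV rhoK] u : exists v, rho v = u.
  have [g gu] := coverpi_surj u; have [h hu] := coverpi_surj (phi u).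
  have gh : (g, h) \in lifted_graph_group phi.
    by rewrite unfold_in /=; apply/eqP; rewrite /= gu hu.
  exists (@coverpi R Z (exist (fun x => x \in lifted_graph_group phi) _ gh)).
  by rewrite rhoE.
exists Z, psi, rho, rhoV; split=> //.
- by exists p2.
- by exists p1.
- by move=> u; apply: rho_inj; exact: rhoK.
- move=> u /=; have [z zu] := coverpi_surj (rhoV u).
  by rewrite -zu psiE -p12 -rhoE zu rhoK.
Qed.

End GraphCover.

(** * From a factorization to a Borel lift *)

Section CoverSection.
Context (R : realType) (X Y Z : polishCover R).
Context (phi : {multiplicative coverq X -> coverq Y}).
Context (psi : {multiplicative coverq Z -> coverq Y}).
Context (rho : {multiplicative coverq Z -> coverq X}).
Context (rhoV : coverq X -> coverq Z).
Hypotheses (psi_air : airomorphism psi) (rho_air : airomorphism rho).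
Hypotheses (rhoK : cancel rho rhoV) (rhoVK : cancel rhoV rho).
Hypothesis phiE : phi =1 psi \o rhoV.

Lemma cover_section_borel_definable : borel_definable phi.
Proof.
have [p pE pc] := psi_air; have [r rE rc] := rho_air.
have [t [NP val_cont]] := cover_kernel_polish X.
pose G := cover_group X; pose N := topologized t.
pose A := (cover_group Z * N)%type.
have GP : polish_group R G by exact: polish_groupP.
have ZP : polish_group R (cover_group Z) by exact: polish_groupP.
have [GM GV _] := GP; have [ZM ZV _] := ZP; have [NM NV _] := NP.
have Gh := polish_group_hausdorff GP.
pose bA := polish_base_prod (polish_group_base ZP) (polish_group_base NP).
have r1 : r 1 = 1 by apply: (mulgI (r 1)); rewrite -gmulfM !mulg1.
pose act (a : A) (y : G) : G := r a.1 * y * (val a.2)^-1.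
have act1 y : act 1 y = y.
  by rewrite -[LHS]/(r 1 * y * 1^-1) r1 mul1g invg1 mulg1.
have actM g h y : act (g * h) y = act g (act h y).
  rewrite -[LHS]/(r (g.1 * h.1) * y * (val g.2 * val h.2)^-1).
  by rewrite /act invgM gmulfM !mulgA.
have act_cont g : continuous (act g).
  apply: continuous_mulg => //; last exact: cst_continuous.
  apply: continuous_mulg => //; first exact: cst_continuous.
  by move=> y; exact: cvg_id.
have orbit_cont y : continuous (act^~ y).
  apply: continuous_mulg => //.
    apply: continuous_mulg => //; last exact: cst_continuous.
    exact: continuous_compT (@continuous_fst _ _) rc.
  apply: (continuous_compT (g := fun x : G => x^-1)) => //.
  exact: continuous_compT (@continuous_snd _ _) val_cont.
(* Surjectivity of [rho] gives [z] with [y * x^-1 = r z * m] and [m] in the kernel; then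
   [y = r z * x * m ^ x], and normality allows [n = (m ^ x)^-1]. *)
have act_trans x y : exists g, act g x = y.
  have [z zE] := coverpi_surj (rhoV (coverpi (y * x^-1))).
  have mN : (r z)^-1 * (y * x^-1) \in cover_kernel X.
    by apply/eq_coverpi; rewrite -rE zE rhoVK.
  have nN : (((r z)^-1 * (y * x^-1)) ^ x)^-1 \in cover_kernel X.
    by rewrite gpredV; exact: gpredJl.
  exists (z, exist (fun g => g \in cover_kernel X) _ nN).
  by rewrite /act /= invgK /conjg !mulgA mulgK mulgV mul1g mulgVK.
have [||s [sb sE]] := @borel_section A G bA (act^~ 1) Gh (orbit_cont 1).
- move=> U oU; apply: (@orbit_map_open _ _ bA (polish_group_base GP)) => //.
  + exact: continuous_mulg_prod.
  + exact: continuous_invg_prod.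
- by move=> y; have [g gy] := act_trans 1 y; exists g.
(* The section writes [g] as [r z * n^-1] with [z = (s g).1], so [rho] sends the coset of [z] to
   that of [g], and [phi] of the latter is the coset of [p z]. *)
exists (fun g => p (s g).1).
  move=> g; rewrite phiE /= -pE; congr (psi _).
  rewrite -(rhoK (coverpi (s g).1)) rE; congr rhoV; apply/esym/eq_coverpi.
  rewrite -[X in _ * X](sE g) /act mulg1 mulKg gpredV; exact: (valP (s g).2).
apply: (borel_fun_comp (f := fun g => (s g).1)); last exact: borel_fun_continuous.
apply: (borel_fun_comp sb); apply: borel_fun_continuous; exact: continuous_fst.
Qed.

End CoverSection.

Theorem proposition4p6 (R : realType) (X Y : polishCover R)
    (phi : {multiplicative coverq X -> coverq Y}) :
  [<-> borel_definable phi;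
       polish_cover_hom phi;
       exists (Z : polishCover R)
              (psi : {multiplicative coverq Z -> coverq Y})
              (rho : {multiplicative coverq Z -> coverq X})
              (rhoV : coverq X -> coverq Z),
         [/\ airomorphism psi, airomorphism rho,
             cancel rho rhoV, cancel rhoV rho & phi =1 psi \o rhoV]].
Proof.
tfae.
- move=> [f f_lift f_borel]; have [t [MP val_cont]] := cover_kernel_polish Y.
  exact: (borel_lift_polish_cover_hom f_lift f_borel MP val_cont).
- by move=> [t [GammaP val_cont]]; exact: (graph_cover GammaP val_cont).
- move=> [Z [psi [rho [rhoV [psi_air rho_air rhoK rhoVK phiE]]]]].
  exact: (cover_section_borel_definable psi_air rho_air rhoK rhoVK phiE).
Qed.
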